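(* If the algorithm SQEMA succeeds on a formula $\phi$ of the basic modal language $\mathrm{ML}$, then $\phi$ is locally d-persistent (and hence canonical), and the first-order formula $\alpha(y_{\mathbf{i}})$ returned by SQEMA is a local first-order equivalent of $\phi$: for every Kripke frame $\mathfrak{F}=(W,R)$ and every $w\in W$, $\mathfrak{F},w\Vdash\phi$ iff $\mathfrak{F}\models\alpha[y_{\mathbf{i}}:=w]$.
   Context: $\mathrm{ML}$: formulae from $\top,\bot$, propositional variables with $\neg,\wedge,\vee,\Diamond,\Box$. $\mathrm{ML}^+$ adds nominals (variables always denoting singletons) and $\Diamond^{-1},\Box^{-1}$ ($\Diamond^{-1}\phi$ true at $u$ iff $\phi$ true at some $w$ with $Rwu$). Positive/negative occurrences: even/odd number of negations in scope; a system is positive (negative) in $p$ if all occurrences of $p$ are; nominals are disregarded. A general frame $\langle W,R,\mathbb{W}\rangle$ has $\mathbb{W}$ a Boolean algebra of subsets of $W$ closed under $\Diamond X=\{x:\exists y\in X, Rxy\}$; it is descriptive if differentiated (distinct points separated by an admissible set), tight ($Rxy$ iff $x\in\bigcap\{\Diamond Y: Y\in\mathbb{W}, y\in Y\}$) and compact (every subfamily of $\mathbb{W}$ with the finite intersection property has nonempty intersection). $\mathfrak{F},w\Vdash\phi$ means $\phi$ is true at $w$ under every valuation of propositional variables by admissible sets (all subsets for Kripke frames). $\phi\in\mathrm{ML}$ is locally d-persistent if for every descriptive frame $\langle W,R,\mathbb{W}\rangle$ and $w\in W$: $\langle W,R,\mathbb{W}\rangle,w\Vdash\phi$ iff $\langle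 W,R\rangle,w\Vdash\phi$. Canonical means valid on the canonical frame of every normal modal logic containing it. SQEMA. Rewriting rules on systems (finite sets, read conjunctively and globally) of equations $\alpha\rightarrow\beta$ in $\mathrm{ML}^+$: $\wedge$-rule ($\beta\rightarrow\gamma\wedge\delta$ becomes $\beta\rightarrow\gamma$, $\beta\rightarrow\delta$); left-shift $\vee$-rule ($\beta\rightarrow\gamma\vee\delta$ becomes $(\beta\wedge\neg\gamma)\rightarrow\delta$) and its converse; left-shift $\Box$-rule ($\gamma\rightarrow\Box\delta$ becomes $\Diamond^{-1}\gamma\rightarrow\delta$) and its converse; $\Diamond$-rule ($\mathbf{j}\rightarrow\Diamond\gamma$, $\mathbf{j}$ a nominal, becomes $\mathbf{j}\rightarrow\Diamond\mathbf{k}$, $\mathbf{k}\rightarrow\gamma$, $\mathbf{k}$ a new nominal); Ackermann-rule (if the equations containing $p$ are exactly $\alpha_1\rightarrow p,\ldots,\alpha_n\rightarrow p$ with $p$ not in the $\alpha$'s, and $\beta_1,\ldots,\beta_m$ each negative in $p$, replace them by $\beta_j[(\alpha_1\vee\cdots\vee\alpha_n)/p]$); polarity switching (replace $p$ by $\neg p$ and $\neg p$ by $p$ throughout); auxiliary rules (commutativity/associativity of $\wedge,\vee$; $\gamma\vee\neg\gamma\mapsto\top$, $\gamma\wedge\neg\gamma\mapsto\bot$, $\gamma\vee\top\mapsto\top$, $\gamma\vee\bot\mapsto\gamma$, $\gamma\wedge\top\mapsto\gamma$, $\gamma\wedge\bot\mapsto\bot$, $\gamma\rightarrow\bot\mapsto\neg\gamma$,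 $\gamma\rightarrow\top\mapsto\top$, $\bot\rightarrow\gamma\mapsto\top$, $\top\rightarrow\gamma\mapsto\gamma$, $\neg\Diamond\neg\mapsto\Box$, $\neg\Box\neg\mapsto\Diamond$). On input $\phi$: (1) put $\neg\phi$ in negation normal form and distribute $\Diamond$ and $\wedge$ over $\vee$ as much as possible, giving $\bigvee_k\alpha_k$; (2) for each $k$ start from $\{\mathbf{i}\rightarrow\alpha_k\}$, $\mathbf{i}$ a reserved nominal; (3) replace each variable in which the system is positive (negative) by $\top$ ($\bot$); (4–5) repeatedly choose a remaining variable and use the rules (possibly polarity switching) to enable and apply the Ackermann-rule to eliminate it, backtracking over choices. SQEMA succeeds on $\phi$ if for every $k$ some such sequence of steps yields a system with no propositional variables. (6) Output: for each final system let $\mathsf{pure}_k$ be the conjunction of its equations; return $\bigwedge_k\forall\bar y\,\exists x_0\,\mathrm{ST}(\neg\mathsf{pure}_k,x_0)$, where $\bar y$ are the variables $y_{\mathbf{j}}$ for nominals $\mathbf{j}\neq\mathbf{i}$ and $y_{\mathbf{i}}$ is left free. The standard translation: $\mathrm{ST}(p,x)=P(x)$, $\mathrm{ST}(\mathbf{j},x)=(x=y_{\mathbf{j}})$, commutes with Boolean connectives, $\mathrm{ST}(\Diamond\psi,x)=\exists y(Rxy\wedge\mathrm{ST}(\psi,y))$, $\mathrm{ST}(\Box\psi,x)=\forall y(Rxy\rightarrow\mathrm{ST}(\psi,y))$, $\mathrm{ST}(\Diamond^{-1}\psi,x)=\exists y(Ryx\wedge\mathrm{ST}(\psi,y))$,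 $\mathrm{ST}(\Box^{-1}\psi,x)=\forall y(Ryx\rightarrow\mathrm{ST}(\psi,y))$ ($y$ fresh). *)

(* Defs.v *)
From HB Require Import structures.
From Stdlib Require List PeanoNat.
From Stdlib Require Import Relation_Operators.
From mathcomp Require Import all_boot.
From mathcomp Require Import classical_sets.

Set Implicit Arguments.
Unset Strict Implicit.
Unset Printing Implicit Defensive.

Local Open Scope classical_set_scope.

Inductive ml : Type :=
| MTop | MBot
| MVar of nat
| MNeg of ml
| MAnd of ml & ml
| MOr of ml & ml
| MDia of ml
| MBox of ml.

Definition MImp (a b : ml) : ml := MOr (MNeg a) b.

Section Semantics.
Variables (W : Type) (R : W -> W -> Prop).

Definition diaset (X : set W) : set W := [set x | exists2 y, X y & R x y].

Fixpoint truth (V : nat -> set W) (phi : ml) (w : W) : Prop :=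
  match phi with
  | MTop => True
  | MBot => False
  | MVar p => V p w
  | MNeg a => ~ truth V a w
  | MAnd a b => truth V a w /\ truth V b w
  | MOr a b => truth V a w \/ truth V b w
  | MDia a => exists u, R w u /\ truth V a u
  | MBox a => forall u, R w u -> truth V a u
  end.

(* A general frame is (W, R, A) with A the family of admissible sets. *)
Record general_frame (A : set (set W)) : Prop := {
  admissible_setT : A setT;
  admissible_setC : forall X, A X -> A (~` X);
  admissible_setI : forall X Y, A X -> A Y -> A (X `&` Y);
  admissible_dia : forall X, A X -> A (diaset X)
}.

Definition differentiated (A : set (set W)) : Prop :=
  forall x y : W, x <> y -> exists X, [/\ A X, X x & ~ X y].

Definition tight (A : set (set W)) : Prop :=
  forall x y : W, R x y <-> (\bigcap_(Y in [set Y | A Y /\ Y y]) diaset Y) x.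

Definition finite_intersection_property (F : set (set W)) : Prop :=
  forall (n : nat) (Y : 'I_n -> set W),
    (forall k, F (Y k)) -> exists x, forall k, Y k x.

Definition compact_family (A : set (set W)) : Prop :=
  forall F : set (set W), F `<=` A -> finite_intersection_property F ->
    (\bigcap_(X in F) X) !=set0.

Definition descriptive (A : set (set W)) : Prop :=
  [/\ general_frame A, differentiated A, tight A & compact_family A].

Definition gframe_forces (A : set (set W)) (w : W) (phi : ml) : Prop :=
  forall V : nat -> set W, (forall p, A (V p)) -> truth V phi w.

Definition kframe_forces (w : W) (phi : ml) : Prop :=
  forall V : nat -> set W, truth V phi w.

End Semantics.

Definition locally_d_persistent (phi : ml) : Prop :=
  forall (W : Type) (R : W -> W -> Prop) (A : set (set W)),
    descriptive R A ->
    forall w : W, gframe_forces R A w phi <-> kframe_forces R w phi.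

Fixpoint msubst (s : nat -> ml) (phi : ml) : ml :=
  match phi with
  | MTop => MTop
  | MBot => MBot
  | MVar p => s p
  | MNeg a => MNeg (msubst s a)
  | MAnd a b => MAnd (msubst s a) (msubst s b)
  | MOr a b => MOr (msubst s a) (msubst s b)
  | MDia a => MDia (msubst s a)
  | MBox a => MBox (msubst s a)
  end.

(* Truth-functional evaluation, with variables and formulae of the form
   MDia a or MBox a as atoms. *)
Fixpoint bool_eval (v : ml -> bool) (phi : ml) : bool :=
  match phi with
  | MTop => true
  | MBot => false
  | MNeg a => ~~ bool_eval v a
  | MAnd a b => bool_eval v a && bool_eval v b
  | MOr a b => bool_eval v a || bool_eval v b
  | MVar _ | MDia _ | MBox _ => v phi
  end.

Definition tautology (phi : ml) : Prop := forall v, bool_eval v phi.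

Record normal_modal_logic (L : set ml) : Prop := {
  nml_taut : forall a, tautology a -> L a;
  nml_K : forall a b, L (MImp (MBox (MImp a b)) (MImp (MBox a) (MBox b)));
  nml_dual1 : forall a, L (MImp (MDia a) (MNeg (MBox (MNeg a))));
  nml_dual2 : forall a, L (MImp (MNeg (MBox (MNeg a))) (MDia a));
  nml_mp : forall a b, L (MImp a b) -> L a -> L b;
  nml_subst : forall s a, L a -> L (msubst s a);
  nml_nec : forall a, L a -> L (MBox a)
}.

Definition consistent (L G : set ml) : Prop :=
  forall (n : nat) (f : 'I_n -> ml), (forall k, G (f k)) ->
    ~ L (MNeg (\big[MAnd/MTop]_(k < n) f k)).

Definition maximal_consistent (L G : set ml) : Prop :=
  consistent L G /\ forall H : set ml, consistent L H -> G `<=` H -> H `<=` G.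

Definition canonical_world (L : set ml) : Type :=
  {G : set ml | maximal_consistent L G}.

Definition canonical_rel (L : set ml) (G H : canonical_world L) : Prop :=
  forall a, sval G (MBox a) -> sval H a.

Definition canonical (phi : ml) : Prop :=
  forall L : set ml, normal_modal_logic L -> L phi ->
    forall G : canonical_world L, kframe_forces (@canonical_rel L) G phi.

Inductive mlp : Type :=
| Top | Bot
| Var of nat
| Nom of nat
| Neg of mlp
| And of mlp & mlp
| Or of mlp & mlp
| Dia of mlp
| Box of mlp
| DiaI of mlp
| BoxI of mlp.

Definition mlp_comparable : comparable mlp.
Proof. by move=> a b; rewrite /decidable; decide equality; apply: PeanoNat.Nat.eq_dec. Defined.

HB.instance Definition _ := hasDecEq.Build mlp (compareP mlp_comparable).

Fixpoint embed (phi : ml) : mlp :=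
  match phi with
  | MTop => Top
  | MBot => Bot
  | MVar p => Var p
  | MNeg a => Neg (embed a)
  | MAnd a b => And (embed a) (embed b)
  | MOr a b => Or (embed a) (embed b)
  | MDia a => Dia (embed a)
  | MBox a => Box (embed a)
  end.

(* The reserved nominal i. *)
Definition inom : nat := 0.

Fixpoint pvars (a : mlp) : seq nat :=
  match a with
  | Top | Bot | Nom _ => [::]
  | Var p => [:: p]
  | Neg b | Dia b | Box b | DiaI b | BoxI b => pvars b
  | And b c | Or b c => pvars b ++ pvars c
  end.

Fixpoint noms (a : mlp) : seq nat :=
  match a with
  | Top | Bot | Var _ => [::]
  | Nom j => [:: j]
  | Neg b | Dia b | Box b | DiaI b | BoxI b => noms b
  | And b c | Or b c => noms b ++ noms c
  end.

(* [polar true p a]: all occurrences of p in a are positive;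
   [polar false p a]: all are negative. *)
Fixpoint polar (s : bool) (p : nat) (a : mlp) : bool :=
  match a with
  | Top | Bot | Nom _ => true
  | Var q => (q == p) ==> s
  | Neg b => polar (~~ s) p b
  | Dia b | Box b | DiaI b | BoxI b => polar s p b
  | And b c | Or b c => polar s p b && polar s p c
  end.

Fixpoint subst (s : nat -> mlp) (a : mlp) : mlp :=
  match a with
  | Top => Top
  | Bot => Bot
  | Var p => s p
  | Nom j => Nom j
  | Neg b => Neg (subst s b)
  | And b c => And (subst s b) (subst s c)
  | Or b c => Or (subst s b) (subst s c)
  | Dia b => Dia (subst s b)
  | Box b => Box (subst s b)
  | DiaI b => DiaI (subst s b)
  | BoxI b => BoxI (subst s b)
  end.

Definition subst1 (p : nat) (g : mlp) : nat -> mlp :=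
  fun q => if q == p then g else Var q.

(* Exchanges p and "not p": each subformula Neg (Var p) becomes Var p and
   each other occurrence of Var p becomes Neg (Var p). *)
Fixpoint switch (p : nat) (a : mlp) : mlp :=
  match a with
  | Top => Top
  | Bot => Bot
  | Var q => if q == p then Neg (Var q) else Var q
  | Nom j => Nom j
  | Neg (Var q) => if q == p then Var q else Neg (Var q)
  | Neg b => Neg (switch p b)
  | And b c => And (switch p b) (switch p c)
  | Or b c => Or (switch p b) (switch p c)
  | Dia b => Dia (switch p b)
  | Box b => Box (switch p b)
  | DiaI b => DiaI (switch p b)
  | BoxI b => BoxI (switch p b)
  end.

Fixpoint bigOr (s : seq mlp) : mlp :=
  match s with
  | [::] => Bot
  | [:: a] => a
  | a :: s' => Or a (bigOr s')
  end.

Fixpoint bigAnd (s : seq mlp) : mlp :=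
  match s with
  | [::] => Top
  | [:: a] => a
  | a :: s' => And a (bigAnd s')
  end.

Inductive in_context (r : mlp -> mlp -> Prop) : mlp -> mlp -> Prop :=
| ctx_here a b : r a b -> in_context r a b
| ctx_Neg a b : in_context r a b -> in_context r (Neg a) (Neg b)
| ctx_AndL a b c : in_context r a b -> in_context r (And a c) (And b c)
| ctx_AndR a b c : in_context r a b -> in_context r (And c a) (And c b)
| ctx_OrL a b c : in_context r a b -> in_context r (Or a c) (Or b c)
| ctx_OrR a b c : in_context r a b -> in_context r (Or c a) (Or c b)
| ctx_Dia a b : in_context r a b -> in_context r (Dia a) (Dia b)
| ctx_Box a b : in_context r a b -> in_context r (Box a) (Box b)
| ctx_DiaI a b : in_context r a b -> in_context r (DiaI a) (DiaI b)
| ctx_BoxI a b : in_context r a b -> in_context r (BoxI a) (BoxI b).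

(* Some auxiliary rules, e.g. from (g -> bot) to (not g), leave a formula that
   is no longer an implication: [EFml]. *)
Inductive eqn : Type :=
| EImp of mlp & mlp
| EFml of mlp.

Definition eqn_comparable : comparable eqn.
Proof. by move=> e f; rewrite /decidable; decide equality; apply: mlp_comparable. Defined.

HB.instance Definition _ := hasDecEq.Build eqn (compareP eqn_comparable).

Definition eqn_formula (e : eqn) : mlp :=
  match e with
  | EImp a b => Or (Neg a) b
  | EFml a => a
  end.

Definition eqn_map (f : mlp -> mlp) (e : eqn) : eqn :=
  match e with
  | EImp a b => EImp (f a) (f b)
  | EFml a => EFml (f a)
  end.

(* Finite sets of equations are lists taken up to [=i]. *)
Definition system := seq eqn.

Definition sys_pvars (S : system) : seq nat :=
  flatten [seq pvars (eqn_formula e) | e <- S].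
Definition sys_noms (S : system) : seq nat :=
  flatten [seq noms (eqn_formula e) | e <- S].
Definition sys_polar (s : bool) (p : nat) (S : system) : bool :=
  all (fun e => polar s p (eqn_formula e)) S.

Inductive aux_rule : mlp -> mlp -> Prop :=
| aux_AndC a b : aux_rule (And a b) (And b a)
| aux_OrC a b : aux_rule (Or a b) (Or b a)
| aux_AndA a b c : aux_rule (And a (And b c)) (And (And a b) c)
| aux_AndA' a b c : aux_rule (And (And a b) c) (And a (And b c))
| aux_OrA a b c : aux_rule (Or a (Or b c)) (Or (Or a b) c)
| aux_OrA' a b c : aux_rule (Or (Or a b) c) (Or a (Or b c))
| aux_OrN a : aux_rule (Or a (Neg a)) Top
| aux_AndN a : aux_rule (And a (Neg a)) Bot
| aux_OrTop a : aux_rule (Or a Top) Top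
| aux_OrBot a : aux_rule (Or a Bot) a
| aux_AndTop a : aux_rule (And a Top) a
| aux_AndBot a : aux_rule (And a Bot) Bot
| aux_NDiaN a : aux_rule (Neg (Dia (Neg a))) (Box a)
| aux_NBoxN a : aux_rule (Neg (Box (Neg a))) (Dia a).

Inductive eqn_rule : eqn -> seq eqn -> Prop :=
| rule_And b c d :
    eqn_rule (EImp b (And c d)) [:: EImp b c; EImp b d]
| rule_OrL b c d :
    eqn_rule (EImp b (Or c d)) [:: EImp (And b (Neg c)) d]
| rule_OrR b c d :
    eqn_rule (EImp (And b (Neg c)) d) [:: EImp b (Or c d)]
| rule_BoxL c d :
    eqn_rule (EImp c (Box d)) [:: EImp (DiaI c) d]
| rule_BoxR c d :
    eqn_rule (EImp (DiaI c) d) [:: EImp c (Box d)]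
| rule_impBot c : eqn_rule (EImp c Bot) [:: EFml (Neg c)]
| rule_impTop c : eqn_rule (EImp c Top) [:: EFml Top]
| rule_Botimp c : eqn_rule (EImp Bot c) [:: EFml Top]
| rule_Topimp c : eqn_rule (EImp Top c) [:: EFml c]
| rule_auxL a a' b : in_context aux_rule a a' ->
    eqn_rule (EImp a b) [:: EImp a' b]
| rule_auxR a b b' : in_context aux_rule b b' ->
    eqn_rule (EImp a b) [:: EImp a b']
| rule_auxF a a' : in_context aux_rule a a' ->
    eqn_rule (EFml a) [:: EFml a'].

Definition replace_eqn (e : eqn) (es : seq eqn) (S T : system) : Prop :=
  exists U : system, [/\ e \notin U, S =i e :: U & T =i es ++ U].

(* In the Ackermann-rule the equations not containing p are vacuously negative
   in p and unchanged by the substitution, so they are counted among the betas;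
   the empty disjunction is Bot. *)
Inductive sqema_step (S T : system) : Prop :=
| step_eqn e es : eqn_rule e es -> replace_eqn e es S T -> sqema_step S T
| step_Dia j k c : k != inom -> k \notin sys_noms S ->
    replace_eqn (EImp (Nom j) (Dia c))
      [:: EImp (Nom j) (Dia (Nom k)); EImp (Nom k) c] S T ->
    sqema_step S T
| step_Ackermann p (alphas : seq mlp) (betas : system) :
    S =i [seq EImp a (Var p) | a <- alphas] ++ betas ->
    all (fun a => p \notin pvars a) alphas ->
    sys_polar false p betas ->
    T =i [seq eqn_map (subst (subst1 p (bigOr alphas))) e | e <- betas] ->
    sqema_step S T
| step_switch p :
    T =i [seq eqn_map (switch p) e | e <- S] -> sqema_step S T.

(* [nnf true a] is the negation normal form of a, [nnf false a] that of Neg a. *)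
Fixpoint nnf (s : bool) (a : mlp) : mlp :=
  match a with
  | Top => if s then Top else Bot
  | Bot => if s then Bot else Top
  | Var p => if s then Var p else Neg (Var p)
  | Nom j => if s then Nom j else Neg (Nom j)
  | Neg b => nnf (~~ s) b
  | And b c => if s then And (nnf s b) (nnf s c) else Or (nnf s b) (nnf s c)
  | Or b c => if s then Or (nnf s b) (nnf s c) else And (nnf s b) (nnf s c)
  | Dia b => if s then Dia (nnf s b) else Box (nnf s b)
  | Box b => if s then Box (nnf s b) else Dia (nnf s b)
  | DiaI b => if s then DiaI (nnf s b) else BoxI (nnf s b)
  | BoxI b => if s then BoxI (nnf s b) else DiaI (nnf s b)
  end.

Inductive dist_rule : mlp -> mlp -> Prop :=
| dist_Dia a b : dist_rule (Dia (Or a b)) (Or (Dia a) (Dia b))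
| dist_AndL a b c : dist_rule (And (Or a b) c) (Or (And a c) (And b c))
| dist_AndR a b c : dist_rule (And c (Or a b)) (Or (And c a) (And c b)).

Fixpoint disjuncts (a : mlp) : seq mlp :=
  match a with
  | Or b c => disjuncts b ++ disjuncts c
  | _ => [:: a]
  end.

Definition preprocess (phi : ml) (alphas : seq mlp) : Prop :=
  exists psi : mlp,
    [/\ clos_refl_trans mlp (in_context dist_rule)
          (nnf true (Neg (embed phi))) psi,
        (forall psi', ~ in_context dist_rule psi psi')
      & alphas = disjuncts psi].

Definition monotone_elim (S : system) : system :=
  [seq eqn_map (subst (fun p =>
      if sys_polar true p S then Top
      else if sys_polar false p S then Bot
      else Var p)) e | e <- S].

Definition successful_run (alpha : mlp) (S : system) : Prop :=
  clos_refl_trans system sqema_step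
    (monotone_elim [:: EImp (Nom inom) alpha]) S
  /\ sys_pvars S = [::].

Definition successful_execution (phi : ml) (finals : seq system) : Prop :=
  exists alphas : seq mlp,
    preprocess phi alphas /\ List.Forall2 successful_run alphas finals.

Definition sqema_succeeds (phi : ml) : Prop :=
  exists finals : seq system, successful_execution phi finals.

(* Individual variables: x_ n, and y_ j for each nominal j. *)
Notation fovar := (nat + nat)%type.
Definition x_ (n : nat) : fovar := inl n.
Definition y_ (j : nat) : fovar := inr j.

Inductive fo : Type :=
| FTrue | FFalse
| FRel of fovar & fovar
| FEq of fovar & fovar
| FPred of nat & fovar
| FNot of fo
| FAnd of fo & fo
| FOr of fo & fo
| FImp of fo & fo
| FEx of fovar & fo
| FAll of fovar & fo.

Definition update (W : Type) (e : fovar -> W) (x : fovar) (w : W) : fovar -> W :=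
  fun z => if z == x then w else e z.

Fixpoint sat (W : Type) (R : W -> W -> Prop) (V : nat -> set W)
    (e : fovar -> W) (f : fo) : Prop :=
  match f with
  | FTrue => True
  | FFalse => False
  | FRel x y => R (e x) (e y)
  | FEq x y => e x = e y
  | FPred p x => V p (e x)
  | FNot g => ~ sat R V e g
  | FAnd g h => sat R V e g /\ sat R V e h
  | FOr g h => sat R V e g \/ sat R V e h
  | FImp g h => sat R V e g -> sat R V e h
  | FEx x g => exists w, sat R V (update e x w) g
  | FAll x g => forall w, sat R V (update e x w) g
  end.

Fixpoint frame_language (f : fo) : bool :=
  match f with
  | FTrue | FFalse | FRel _ _ | FEq _ _ => true
  | FPred _ _ => false
  | FNot g | FEx _ g | FAll _ g => frame_language g
  | FAnd g h | FOr g h | FImp g h => frame_language g && frame_language h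
  end.

Fixpoint free_vars (f : fo) : seq fovar :=
  match f with
  | FTrue | FFalse => [::]
  | FRel x y | FEq x y => [:: x; y]
  | FPred _ x => [:: x]
  | FNot g => free_vars g
  | FAnd g h | FOr g h | FImp g h => free_vars g ++ free_vars h
  | FEx x g | FAll x g => [seq z <- free_vars g | z != x]
  end.

(* [ST a n] is ST(a, x_n); x_(n+1) is the fresh variable, since x_n is the
   only x-variable free in ST(a, x_n). *)
Fixpoint ST (a : mlp) (n : nat) : fo :=
  match a with
  | Top => FTrue
  | Bot => FFalse
  | Var p => FPred p (x_ n)
  | Nom j => FEq (x_ n) (y_ j)
  | Neg b => FNot (ST b n)
  | And b c => FAnd (ST b n) (ST c n)
  | Or b c => FOr (ST b n) (ST c n)
  | Dia b => FEx (x_ n.+1) (FAnd (FRel (x_ n) (x_ n.+1)) (ST b n.+1))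
  | Box b => FAll (x_ n.+1) (FImp (FRel (x_ n) (x_ n.+1)) (ST b n.+1))
  | DiaI b => FEx (x_ n.+1) (FAnd (FRel (x_ n.+1) (x_ n)) (ST b n.+1))
  | BoxI b => FAll (x_ n.+1) (FImp (FRel (x_ n.+1) (x_ n)) (ST b n.+1))
  end.

Definition pure (S : system) : mlp := bigAnd [seq eqn_formula e | e <- S].

Definition sys_output (S : system) : fo :=
  foldr (fun j f => FAll (y_ j) f)
    (FEx (x_ 0) (ST (Neg (pure S)) 0))
    [seq j <- undup (noms (pure S)) | j != inom].

Definition sqema_output (finals : seq system) : fo :=
  foldr FAnd FTrue [seq sys_output T | T <- finals].

Definition local_fo_equivalent (phi : ml) (alpha : fo) : Prop :=
  [/\ frame_language alpha,
      {subset free_vars alpha <= [:: y_ inom]}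
    & forall (W : Type) (R : W -> W -> Prop) (w : W)
             (V : nat -> set W) (e : fovar -> W),
        e (y_ inom) = w ->
        (kframe_forces R w phi <-> sat R V e alpha)].

(* Main.v *)
Require Import Defs.
From Stdlib Require Import Relation_Operators.
From Stdlib Require List.
From mathcomp Require Import all_boot.
From mathcomp Require Import boolp classical_sets.
Import Defs.

(* Let A be the admissible sets of a descriptive frame, or all sets of worlds.
   The invariant of a run is: some valuation in A and some assignment of the
   nominals sending i to w make the system globally true. Initially (jointly
   over the disjuncts) it says that phi fails at w for some valuation in A;
   for a pure system it does not depend on A, and it is the negation of the
   output. Only the Ackermann rule is delicate: the minimal valuation, the
   union of the alphas, need not be admissible. But every equation consists of
   a syntactically closed antecedent and a syntactically open consequent, so
   the minimal valuation is closed in the topology with base A, and by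
   compactness the betas, being true for it, are already true for some
   admissible superset. Canonicity follows because the canonical general frame
   is descriptive and forces every theorem of the logic. *)

Set Implicit Arguments.
Unset Strict Implicit.
Unset Printing Implicit Defensive.

Local Open Scope classical_set_scope.

(** * Semantics of the extended language *)

Definition boxset W (R : W -> W -> Prop) (X : set W) : set W :=
  [set x | R x `<=` X].

Definition conv W (R : W -> W -> Prop) (x y : W) : Prop := R y x.

Section Semantics.
Variables (W : Type) (R : W -> W -> Prop).
Implicit Types (V : nat -> set W) (N : nat -> W) (X Y : set W).

Fixpoint ext V N (a : mlp) : set W :=
  match a with
  | Top => setT
  | Bot => set0
  | Var p => V p
  | Nom j => [set N j]
  | Neg b => ~` ext V N b
  | And b c => ext V N b `&` ext V N c
  | Or b c => ext V N b `|` ext V N c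
  | Dia b => diaset R (ext V N b)
  | Box b => boxset R (ext V N b)
  | DiaI b => diaset (conv R) (ext V N b)
  | BoxI b => boxset (conv R) (ext V N b)
  end.

(** The sign matches that of [closedf] and [polar]: a negation only flips it, so one induction
    treats a formula and its complement together. *)
Definition sext V N (s : bool) (a : mlp) : set W :=
  if s then ext V N a else ~` ext V N a.

Lemma setC_dia (S : W -> W -> Prop) X : ~` diaset S X = boxset S (~` X).
Proof.
apply/seteqP; split=> x /= H; first by move=> y Sxy Xy; apply: H; exists y.
by case=> y Xy Sxy; exact: (H y Sxy Xy).
Qed.

Lemma setC_box (S : W -> W -> Prop) X : ~` boxset S X = diaset S (~` X).
Proof. by rewrite -[RHS]setCK setC_dia setCK. Qed.

Lemma ext_embed V N (phi : ml) : ext V N (embed phi) = truth R V phi.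
Proof.
elim: phi => //= [a -> //|a -> b -> //|a -> b -> //|a ->|a -> //].
apply/seteqP; split=> x /=; first by case=> y; exists y.
by case=> y [Rxy Vy]; exists y.
Qed.

Lemma sext_neg V N s a : sext V N s (Neg a) = sext V N (~~ s) a.
Proof. by case: s; rewrite /sext //= setCK. Qed.

(** De Morgan laws bundled as one multirule, so that the same [rewrite] serves every connective. At
    sign [false] a [DiaI] is excluded by [closedf]. *)
Definition sext_falseE V N :=
  ((fun a b => setCI _ _ : sext V N false (And a b) =
      sext V N false a `|` sext V N false b,
    fun a b => setCU _ _ : sext V N false (Or a b) =
      sext V N false a `&` sext V N false b),
   (fun a => setC_dia _ _ : sext V N false (Dia a) =
      boxset R (sext V N false a),
    fun a => setC_box _ _ : sext V N false (Box a) =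
      diaset R (sext V N false a),
    fun a => setC_box _ _ : sext V N false (BoxI a) =
      diaset (conv R) (sext V N false a))).

Lemma ext_nnf V N s a : ext V N (nnf s a) = sext V N s a.
Proof.
elim: a s => [||p|j|a IH|a IHa b IHb|a IHa b IHb|a IH|a IH|a IH|a IH] s /=;
  rewrite ?sext_neg ?IH //; case: s => //=;
  rewrite ?IH ?IHa ?IHb /sext /= ?setCT ?setC0 ?setCI ?setCU ?setC_dia ?setC_box //.
Qed.

Lemma ext_in_context V N (r : mlp -> mlp -> Prop) :
  (forall a b, r a b -> ext V N a = ext V N b) ->
  forall a b, in_context r a b -> ext V N a = ext V N b.
Proof.
move=> Hr a b; elim=> //= {a b}.
all: by move=> *; congruence.
Qed.

Lemma diaset_setU (S : W -> W -> Prop) X Y :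
  diaset S (X `|` Y) = diaset S X `|` diaset S Y.
Proof.
apply/seteqP; split=> x /=.
  by case=> y [Xy|Yy] Sxy; [left|right]; exists y.
by case=> -[y Xy Sxy]; exists y => //; [left|right].
Qed.

Lemma ext_dist V N a b : dist_rule a b -> ext V N a = ext V N b.
Proof. by case=> *; rewrite /= ?diaset_setU ?setIUl ?setIUr. Qed.

Lemma ext_aux V N a b : aux_rule a b -> ext V N a = ext V N b.
Proof.
case=> *; rewrite /= ?setCK ?setC_dia ?setC_box ?setCK //.
- exact: setIC.
- exact: setUC.
- exact: setIA.
- by rewrite setIA.
- exact: setUA.
- by rewrite setUA.
- exact: setUv.
- exact: setICr.
- exact: setUT.
- exact: setU0.
- exact: setIT.
- exact: setI0.
Qed.

Lemma ext_disjuncts V N a w :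
  ext V N a w <-> exists2 b, b \in disjuncts a & ext V N b w.
Proof.
have single c : ext V N c w <-> exists2 b, b \in [:: c] & ext V N b w.
  by split=> [H|[b]]; [exists c; rewrite ?mem_head|rewrite inE => /eqP ->].
elim: a => [||p|j|a _|a _ b _|a IHa b IHb|a _|a _|a _|a _]; try exact: single.
rewrite /=; split.
  by case=> [/IHa [d Hd Hw]|/IHb [d Hd Hw]]; exists d => //; rewrite mem_cat Hd ?orbT.
case=> d; rewrite mem_cat => /orP[Hd Hw|Hd Hw].
  by left; apply/IHa; exists d.
by right; apply/IHb; exists d.
Qed.

(** [polar false p a] means that [p] has no positive occurrence, so each half of the hypothesis asks
    for an inclusion only where occurrences require it. Swapping the halves exchanges [V] and [V'],
    which is the negation case. *)
Lemma ext_mono V V' N a :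
  (forall p, (polar false p a \/ V p `<=` V' p) /\
             (polar true p a \/ V' p `<=` V p)) ->
  ext V N a `<=` ext V' N a.
Proof.
elim: a V V' => [||p|j|a IH|a IHa b IHb|a IHa b IHb|a IH|a IH|a IH|a IH] V V' /= H.
- by [].
- by [].
- by have [[|]] := H p; rewrite ?eqxx.
- by [].
- move=> x /= nVx V'x; apply: nVx; move: V'x; apply: (IH V' V) => p.
  by have [] := H p.
- apply: setISS; [apply: IHa|apply: IHb] => p;
    by have [[/andP[? ?]|?] [/andP[? ?]|?]] := H p; split; auto.
- apply: setUSS; [apply: IHa|apply: IHb] => p;
    by have [[/andP[? ?]|?] [/andP[? ?]|?]] := H p; split; auto.
- by move=> x /= [y /(IH _ _ H) Vy Rxy]; exists y.
- by move=> x /= Hx y /Hx /(IH _ _ H).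
- by move=> x /= [y /(IH _ _ H) Vy Rxy]; exists y.
- by move=> x /= Hx y /Hx /(IH _ _ H).
Qed.

Lemma eq_ext V V' N N' a :
  {in pvars a, V =1 V'} -> {in noms a, N =1 N'} -> ext V N a = ext V' N' a.
Proof.
elim: a => [||p|j|a IH|a IHa b IHb|a IHa b IHb|a IH|a IH|a IH|a IH] //= HV HN.
- by apply: HV; rewrite mem_head.
- by rewrite HN ?mem_head.
- by rewrite IH.
- by rewrite IHa ?IHb // => p Hp; rewrite ?HV ?HN // mem_cat Hp ?orbT.
- by rewrite IHa ?IHb // => p Hp; rewrite ?HV ?HN // mem_cat Hp ?orbT.
- by rewrite IH.
- by rewrite IH.
- by rewrite IH.
- by rewrite IH.
Qed.

Lemma ext_subst V N s a :
  ext V N (subst s a) = ext (fun p => ext V N (s p)) N a.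
Proof. by elim: a => //= [a ->|a -> b ->|a -> b ->|a ->|a ->|a ->|a ->]. Qed.

Definition complv V p : nat -> set W := fun q => if q == p then ~` V q else V q.

Lemma ext_switch V N p a : ext V N (switch p a) = ext (complv V p) N a.
Proof.
elim: a => [||q|j|a IH|a IHa b IHb|a IHa b IHb|a IH|a IH|a IH|a IH] //=.
- by rewrite /complv; case: ifP.
(* [switch] looks inside a negation, so the body is analysed; only a negated variable departs from
   the induction hypothesis. *)
- case: a IH => [||q|j|a|a b|a b|a|a|a|a] IH; rewrite -?IH //=.
  by rewrite /complv; case: ifP; rewrite //= setCK.
- by rewrite IHa IHb.
- by rewrite IHa IHb.
- by rewrite IH.
- by rewrite IH.
- by rewrite IH.
- by rewrite IH.
Qed.

Lemma ext_bigOr V N s w :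
  ext V N (bigOr s) w <-> exists2 a, a \in s & ext V N a w.
Proof.
elim: s => [|a [|b s] IH]; first by split=> // -[].
  split=> [H|[b]]; first by exists a; rewrite ?mem_head.
  by rewrite inE => /eqP ->.
have -> : bigOr [:: a, b & s] = Or a (bigOr (b :: s)) by [].
split=> [[H|/IH [c cs H]]|[c]].
- by exists a; rewrite ?mem_head.
- by exists c => //; rewrite inE cs orbT.
- by rewrite inE => /orP[/eqP ->|cs H]; [left|right; apply/IH; exists c].
Qed.

Lemma ext_bigAnd V N s w :
  ext V N (bigAnd s) w <-> forall a, a \in s -> ext V N a w.
Proof.
elim: s => [|a [|b s] IH]; first by split.
  split=> [H b|H]; last by apply: H; rewrite mem_head.
  by rewrite inE => /eqP ->.
have -> : bigAnd [:: a, b & s] = And a (bigAnd (b :: s)) by [].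
split=> [[Ha /IH Hs] c|H].
  by rewrite inE => /orP[/eqP ->|/Hs].
split; first by apply: H; rewrite mem_head.
by apply/IH => c cs; apply: H; rewrite inE cs orbT.
Qed.

End Semantics.

(** * Syntactically closed and open formulae *)

(* [closedf true a]: a is syntactically closed (nominals and inverse diamonds
   positive, inverse boxes negative); [closedf false a]: a is syntactically
   open. *)
Fixpoint closedf (s : bool) (a : mlp) : bool :=
  match a with
  | Top | Bot | Var _ => true
  | Nom _ => s
  | Neg b => closedf (~~ s) b
  | And b c | Or b c => closedf s b && closedf s c
  | Dia b | Box b => closedf s b
  | DiaI b => s && closedf s b
  | BoxI b => ~~ s && closedf s b
  end.

(** The sign flips at each negation, so [polar s p a] means that every occurrence of [p] is reached
    at sign [true], where [f p] need only be closed. For [s = false]: closed formulae may replace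
    the negative variables of an open formula. *)
Lemma closedf_subst s f a : closedf s a ->
  (forall p, closedf true (f p)) ->
  (forall p, polar s p a \/ closedf false (f p)) -> closedf s (subst f a).
Proof.
move=> Ha Hf; elim: a s Ha =>
  [||p|j|a IH|a IHa b IHb|a IHa b IHb|a IH|a IH|a IH|a IH] s //=.
- by case: s => // _ /(_ p) [|//]; rewrite eqxx.
- by move=> Ha Hp; apply: IH.
- move=> /andP[Ha Hb] Hp; rewrite IHa ?IHb // => p;
  by have [/andP[? ?]|?] := Hp p; auto.
- move=> /andP[Ha Hb] Hp; rewrite IHa ?IHb // => p;
  by have [/andP[? ?]|?] := Hp p; auto.
- exact: IH.
- exact: IH.
- by case/andP=> -> Ha Hp; rewrite IH.
- by case/andP=> -> Ha Hp; rewrite IH.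
Qed.

Lemma closedf_switch s p a : closedf s (switch p a) = closedf s a.
Proof.
elim: a s => [||q|j|a IH|a IHa b IHb|a IHa b IHb|a IH|a IH|a IH|a IH] s //=.
- by case: ifP.
- by case: a IH => [||q|j|a|a b|a b|a|a|a|a] IH; rewrite -?IH //=; case: ifP.
- by rewrite IHa IHb.
- by rewrite IHa IHb.
- by rewrite IH.
- by rewrite IH.
Qed.

Lemma closedf_in_context (r : mlp -> mlp -> Prop) :
  (forall s a b, r a b -> closedf s a -> closedf s b) ->
  forall s a b, in_context r a b -> closedf s a -> closedf s b.
Proof.
move=> Hr s a b Hab; elim: Hab s => //= {a b}.
- by move=> a b Hab s; exact: Hr.
- by move=> a b _ IH s; exact: IH.
- by move=> a b c _ IH s /andP[/IH -> ->].
- by move=> a b c _ IH s /andP[-> /IH ->].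
- by move=> a b c _ IH s /andP[/IH -> ->].
- by move=> a b c _ IH s /andP[-> /IH ->].
- by move=> a b _ IH s /andP[-> /IH ->].
- by move=> a b _ IH s /andP[-> /IH ->].
Qed.

Lemma closedf_aux s a b : aux_rule a b -> closedf s a -> closedf s b.
Proof.
case=> [x y|x y|x y z|x y z|x y z|x y z|x|x|x|x|x|x|x|x] //=; rewrite ?negbK ?andbT //.
- by rewrite andbC.
- by rewrite andbC.
- by rewrite andbA.
- by rewrite andbA.
- by rewrite andbA.
- by rewrite andbA.
Qed.

(** * The topology of a descriptive frame *)

Section Topology.
Variables (W : Type) (R : W -> W -> Prop) (A : set (set W)).
Hypothesis genA : general_frame R A.

Lemma admissibleU X Y : A X -> A Y -> A (X `|` Y).
Proof.
move=> AX AY; rewrite -[X `|` Y]setCK setCU.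
by apply: (admissible_setC genA); apply: (admissible_setI genA);
   apply: (admissible_setC genA).
Qed.

Lemma admissible_box X : A X -> A (boxset R X).
Proof.
move=> AX; rewrite -[X]setCK -setC_dia.
by apply: (admissible_setC genA); apply: (admissible_dia genA);
   apply: (admissible_setC genA).
Qed.

(* Closed in the topology with base [A]. *)
Definition tclosed (X : set W) : Prop :=
  forall x, ~ X x -> exists Y, [/\ A Y, X `<=` Y & ~ Y x].

Lemma tclosed_admissible X : A X -> tclosed X.
Proof. by move=> AX x nXx; exists X; split. Qed.

Lemma tclosedI X Y : tclosed X -> tclosed Y -> tclosed (X `&` Y).
Proof.
move=> cX cY x /not_andP[/cX|/cY] [Z [AZ sZ nZ]]; exists Z; split=> //.
  by move=> y [/sZ].
by move=> y [_ /sZ].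
Qed.

Lemma tclosedU X Y : tclosed X -> tclosed Y -> tclosed (X `|` Y).
Proof.
move=> cX cY x /not_orP[/cX [Z [AZ sZ nZ]] /cY [Z' [AZ' sZ' nZ']]].
exists (Z `|` Z'); split; [exact: admissibleU|exact: setUSS|by case].
Qed.

Lemma tclosed_box X : tclosed X -> tclosed (boxset R X).
Proof.
move=> cX x /existsNP[y /not_implyP[Rxy /cX [Z [AZ sZ nZ]]]].
exists (boxset R Z); split; first exact: admissible_box.
  by move=> z /= Xz u /Xz /sZ.
by move=> /(_ y Rxy).
Qed.

Hypothesis cptA : compact_family A.

(** Compactness speaks of admissible sets only, so it is applied to the admissible supersets of the
    [f i]. If no [f i] is empty, directedness gives them the finite intersection property, and
    closedness puts their common points in every [f i]. *)
Lemma compact_directed (I : Type) (D : set I) (f : I -> set W) :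
  (exists i, D i) -> (forall i, D i -> tclosed (f i)) ->
  (forall i j, D i -> D j -> exists2 k, D k & f k `<=` f i `&` f j) ->
  (forall x, exists2 i, D i & ~ f i x) -> exists2 i, D i & forall x, ~ f i x.
Proof.
move=> [i0 Di0] cf dir cov; apply: contrapT => /forall2NP nemp.
have ne i : D i -> exists x, f i x.
  by move=> Di; have [//|/existsNP[x /contrapT fx]] := nemp i; exists x.
have [||x Hx] := cptA (F := [set Y | A Y /\ exists2 i, D i & f i `<=` Y]).
- by move=> Y [].
- move=> n Y HY.
  (* Induction on the number of sets already bounded from below yields one member of the family
     inside all [Y k]. *)
  suff H : forall m, exists2 i, D i & forall k : 'I_n, k < m -> f i `<=` Y k.
    have [i Di Hi] := H n; have [x fx] := ne i Di; exists x => k; exact: (Hi k (ltn_ord k)).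
  elim=> [|m [i Di Hi]]; first by exists i0.
  have [lt_mn|le_nm] := ltnP m n; last first.
    by exists i => // k _; apply: Hi; apply: leq_trans (ltn_ord k) le_nm.
  have [_ [j Dj Hj]] := HY (Ordinal lt_mn).
  have [k Dk Hk] := dir _ _ Di Dj; exists k => // l.
  rewrite ltnS leq_eqVlt => /orP[/eqP elm|ltm] x /Hk[fi fj]; last exact: (Hi l).
  by have -> : l = Ordinal lt_mn by [apply: val_inj]; exact: Hj.
- have [i Di nfx] := cov x; have [Y [AY sY nY]] := cf i Di x nfx.
  by apply: nY; apply: Hx; split=> //; exists i.
Qed.

Hypothesis difA : differentiated A.

Lemma tclosed_set1 x : tclosed [set x].
Proof.
move=> y nyx; have [|Y [AY Yx nY]] := difA (x := x) (y := y).
  by move=> exy; apply: nyx.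
by exists Y; split=> // z ->.
Qed.

Hypothesis tightA : tight R A.

(** By tightness [R x] is the intersection of the complements of the admissible [Y] with [x] outside
    [diaset R Y]. *)
Lemma tclosed_succ x : tclosed (R x).
Proof.
move=> y nRxy.
have /existsNP[Y /not_implyP[[AY Yy] nY]] :
  ~ (\bigcap_(Y in [set Y | A Y /\ Y y]) diaset R Y) x by move/tightA.
exists (~` Y); split; [exact: (admissible_setC genA)| |by apply].
by move=> z Rxz Yz; apply: nY; exists z.
Qed.

(** If [x] has no successor in [X], the closed sets obtained by intersecting [R x] with the
    admissible supersets of [X] have no common point. Compactness yields one superset [Y] disjoint
    from [R x], and [diaset R Y] separates [x]. *)
Lemma tclosed_dia X : tclosed X -> tclosed (diaset R X).
Proof.
move=> cX x nx.
have [|||y|Y [AY XY] HY] := @compact_directed (set W)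
    [set Y | A Y /\ X `<=` Y] (fun Y => R x `&` Y).
- by exists setT; split=> //; exact: (admissible_setT genA).
- by move=> Y [AY _]; apply: tclosedI; [exact: tclosed_succ|exact: tclosed_admissible].
- move=> Y Z [AY XY] [AZ XZ]; exists (Y `&` Z).
    by split; [exact: (admissible_setI genA)|move=> u Xu; split; auto].
  by move=> u [Ru []].
- have [Rxy|nR] := pselect (R x y); last first.
    by exists setT; [split=> //; exact: (admissible_setT genA)|case].
  have /cX[Y [AY sY nY]] : ~ X y by move=> Xy; apply: nx; exists y.
  by exists Y; [split|case].
- exists (diaset R Y); split; first exact: (admissible_dia genA).
    by move=> z [u /XY Yu Rzu]; exists u.
  by case=> u Yu Rxu; exact: (HY u).
Qed.

(** For [y] outside, tightness gives each [x] in [X] an admissible [Y] around [y] with [x] outside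
    [diaset R Y]. Compactness makes one [Y] serve all of [X], and its complement separates [y]. *)
Lemma tclosed_diaI X : tclosed X -> tclosed (diaset (conv R) X).
Proof.
move=> cX y ny.
have [|||x|Y [AY Yy] HY] := @compact_directed (set W)
    [set Y | A Y /\ Y y] (fun Y => X `&` diaset R Y).
- by exists setT; split=> //; exact: (admissible_setT genA).
- move=> Y [AY _]; apply: tclosedI => //; apply: tclosed_admissible.
  exact: (admissible_dia genA).
- move=> Y Z [AY Yy] [AZ Zy]; exists (Y `&` Z).
    by split; [exact: (admissible_setI genA)|].
  by move=> u [Xu [v [Yv Zv] Ruv]]; split; split=> //; exists v.
- have [Xx|nX] := pselect (X x); last first.
    by exists setT; [split=> //; exact: (admissible_setT genA)|case].
  have /existsNP[Y /not_implyP[[AY Yy] nY]] :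
    ~ (\bigcap_(Y in [set Y | A Y /\ Y y]) diaset R Y) x.
    by move/tightA => Rxy; apply: ny; exists x.
  by exists Y; [split|case].
- exists (~` Y); split; [exact: (admissible_setC genA)| |by apply].
  by move=> z [u Xu Ruz] Yz; apply: (HY u); split=> //; exists z.
Qed.

Lemma tclosed_pred x : tclosed (conv R x).
Proof.
have -> : conv R x = diaset R [set x].
  by apply/seteqP; split=> y /= => [Ryx|[_ -> //]]; exists x.
exact/tclosed_dia/tclosed_set1.
Qed.

(** At sign [false] this says that syntactically open formulae have open extensions. *)
Lemma tclosed_sext V N s a :
  (forall p, A (V p)) -> closedf s a -> tclosed (sext R V N s a).
Proof.
move=> AV; elim: a s => [||p|j|a IH|a IHa b IHb|a IHa b IHb|a IH|a IH|a IH|a IH] s.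
- move=> _; apply: tclosed_admissible; have AT := admissible_setT genA.
  by case: s => //; exact: (admissible_setC genA).
- move=> _; apply: tclosed_admissible; have AT := admissible_setT genA.
  by case: s; rewrite /sext /= ?setC0 // -setCT; exact: (admissible_setC genA).
- move=> _; apply: tclosed_admissible.
  by case: s; rewrite /sext //=; exact: (admissible_setC genA).
- by case: s => // _; exact: tclosed_set1.
- by rewrite sext_neg; exact: IH.
- case/andP=> /IHa ca /IHb cb; move: s ca cb => [|] ca cb; first exact: tclosedI.
  by rewrite sext_falseE; exact: tclosedU.
- case/andP=> /IHa ca /IHb cb; move: s ca cb => [|] ca cb; first exact: tclosedU.
  by rewrite sext_falseE; exact: tclosedI.
- move/IH; case: s => ca; first exact: tclosed_dia.
  by rewrite sext_falseE; exact: tclosed_box.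
- move/IH; case: s => ca; first exact: tclosed_box.
  by rewrite sext_falseE; exact: tclosed_dia.
- by case: s => //= /(IH true) ca; exact: tclosed_diaI.
- case: s => // /(IH false) ca.
  by rewrite sext_falseE; exact: tclosed_diaI.
Qed.

(** * Closed values of a variable and their admissible supersets *)

Definition setv (V : nat -> set W) (p : nat) (X : set W) : nat -> set W :=
  fun q => if q == p then X else V q.

Lemma sext_setv_mono V N s p a X Y : polar s p a -> X `<=` Y ->
  sext R (setv V p X) N s a `<=` sext R (setv V p Y) N s a.
Proof.
move=> pa XY; case: s pa => pa; rewrite /sext; [|apply: subsetC];
  apply: ext_mono => q; rewrite /setv; by case: eqP => [->|_]; split; auto; right.
Qed.

Lemma admissible_setv V p X : (forall q, A (V q)) -> A X ->
  forall q, A (setv V p X q).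
Proof. by move=> AV AX q; rewrite /setv; case: ifP. Qed.

(** If each successor of [x] failed for some [P], compactness would give a single [P] for which all
    of them fail. [S] is a parameter because both [R] and [conv R] are needed. *)
Lemma dia_intersection (S : W -> W -> Prop) V N s p a C x :
  (forall q, A (V q)) -> closedf s a -> polar s p a -> tclosed (S x) ->
  (forall P, A P -> C `<=` P -> diaset S (sext R (setv V p P) N s a) x) ->
  exists2 y, S x y &
    forall P, A P -> C `<=` P -> sext R (setv V p P) N s a y.
Proof.
move=> AV ca pa cS H; apply: contrapT => /forall2NP nH.
have [|||y|P [AP CP] nP] := @compact_directed (set W)
    [set P | A P /\ C `<=` P] (fun P => S x `&` sext R (setv V p P) N s a).
- by exists setT; split=> //; exact: (admissible_setT genA).
- move=> P [AP _]; apply: tclosedI => //; apply: tclosed_sext => //.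
  exact: admissible_setv.
- move=> P Q [AP CP] [AQ CQ]; exists (P `&` Q).
    by split; [exact: (admissible_setI genA)|move=> u Cu; split; auto].
  by move=> u [Su Hu]; split; split=> //; move: Hu; apply: sext_setv_mono => // v [].
- have [nS|/existsNP[P /not_implyP[AP /not_implyP[CP nP]]]] := nH y.
    by exists setT; [split=> //; exact: (admissible_setT genA)|case].
  by exists P; [split|case].
- by have [y Py Sxy] := H P AP CP; exact: (nP y).
Qed.

(* A closed [C] is the directed intersection of its admissible supersets, and a
   syntactically closed formula positive in [p] commutes with it; the diamond
   case is Esakia's lemma. *)
Lemma sext_intersection V N s p a C x :
  (forall q, A (V q)) -> closedf s a -> polar s p a -> tclosed C ->
  (forall P, A P -> C `<=` P -> sext R (setv V p P) N s a x) ->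
  sext R (setv V p C) N s a x.
Proof.
move=> AV ca pa cC.
have AT := admissible_setT genA.
(* A disjunction commutes with the directed intersection: if one side fails at [P] and the other at
   [Q], both fail at the intersection of [P] and [Q]. *)
have union (B1 B2 : set W -> set W) y :
    (forall P Q, P `<=` Q -> B1 P `<=` B1 Q) ->
    (forall P Q, P `<=` Q -> B2 P `<=` B2 Q) ->
    (forall P, A P -> C `<=` P -> (B1 P `|` B2 P) y) ->
    (forall P, A P -> C `<=` P -> B1 P y) \/
    (forall P, A P -> C `<=` P -> B2 P y).
  move=> m1 m2 H; apply: contrapT => /not_orP[].
  move=> /existsNP[P /not_implyP[AP /not_implyP[CP nP]]].
  move=> /existsNP[Q /not_implyP[AQ /not_implyP[CQ nQ]]].
  have [||H1|H2] := H (P `&` Q).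
  - exact: (admissible_setI genA).
  - by move=> u Cu; split; auto.
  - by apply: nP; move: H1; apply: m1 => u [].
  - by apply: nQ; move: H2; apply: m2 => u [].
elim: a s x ca pa => [||q|j|a IH|a IHa b IHb|a IHa b IHb|a IH|a IH|a IH|a IH] s x ca pa.
(* Atoms other than [p] ignore the value of [p], so the single superset [setT] suffices for them. *)
- by move=> /(_ setT); case: s {ca pa} => // H; exact: H.
- by move=> /(_ setT); case: s {ca pa} => // H; exact: H.
(* At [p] itself polarity forces [s = true], and the claim is the closedness of [C]. *)
- rewrite /sext /= /setv; move: pa => /=; case: eqP => [_|_ _].
    case: s ca => //= _ _ H; apply: contrapT => /cC[Y [AY sY]]; apply.
    exact: H.
  by move=> /(_ setT); apply.
- by move=> /(_ setT); case: s {ca pa} => // H; exact: H.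
- by rewrite sext_neg => H; apply: IH => // P AP CP; rewrite -sext_neg; exact: H.
- move: ca pa => /= /andP[ca cb] /andP[pa pb].
  case: s ca cb pa pb => ca cb pa pb H.
    by split; [apply: (IHa true)|apply: (IHb true)] => // P AP CP; have [] := H P AP CP.
  rewrite sext_falseE.
  have [|||H'|H'] := @union (fun P => sext R (setv V p P) N false a)
                         (fun P => sext R (setv V p P) N false b) x.
  + by move=> P Q; exact: sext_setv_mono.
  + by move=> P Q; exact: sext_setv_mono.
  + by move=> P AP CP; have := H P AP CP; rewrite sext_falseE.
  + by left; exact: (IHa false).
  + by right; exact: (IHb false).
- move: ca pa => /= /andP[ca cb] /andP[pa pb].
  case: s ca cb pa pb => ca cb pa pb H; last first.
    rewrite sext_falseE.
    by split; [apply: (IHa false)|apply: (IHb false)] => // P AP CP;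
      have := H P AP CP; rewrite sext_falseE => -[].
  have [|||H'|H'] := @union (fun P => sext R (setv V p P) N true a)
                         (fun P => sext R (setv V p P) N true b) x.
  + by move=> P Q; exact: sext_setv_mono.
  + by move=> P Q; exact: sext_setv_mono.
  + by move=> P AP CP; have := H P AP CP.
  + by left; exact: (IHa true).
  + by right; exact: (IHb true).
- case: s ca pa => ca pa H.
    have [y Rxy Hy] := @dia_intersection R V N true p a C x AV ca pa (tclosed_succ (x := x)) H.
    by exists y => //; exact: (IH true).
  rewrite sext_falseE => y Rxy; apply: (IH false) => // P AP CP.
  by have := H P AP CP; rewrite sext_falseE; apply.
- case: s ca pa => ca pa H.
    by move=> y Rxy; apply: (IH true) => // P AP CP; exact: (H P AP CP).
  rewrite sext_falseE.
  have [|y Rxy Hy] := @dia_intersection R V N false p a C x AV ca pa (tclosed_succ (x := x)).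
    by move=> P AP CP; have := H P AP CP; rewrite sext_falseE.
  by exists y => //; exact: (IH false).
- case: s ca pa => //= ca pa H.
  have [y Rxy Hy] := @dia_intersection (conv R) V N true p a C x AV ca pa (tclosed_pred (x := x)) H.
  by exists y => //; exact: (IH true).
- case: s ca pa => // ca pa H; rewrite sext_falseE.
  have [|y Rxy Hy] := @dia_intersection (conv R) V N false p a C x AV ca pa (tclosed_pred (x := x)).
    by move=> P AP CP; have := H P AP CP; rewrite sext_falseE.
  by exists y => //; exact: (IH false).
Qed.

(** The points where [a] fails for [P] form closed sets that shrink with [P]. By [sext_intersection]
    a point common to all of them would refute [a] at [C], so compactness makes one of them
    empty. *)
Lemma ackermann_formula V N p a C :
  (forall q, A (V q)) -> closedf false a -> polar false p a -> tclosed C ->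
  (forall x, ext R (setv V p C) N a x) ->
  exists P, [/\ A P, C `<=` P & forall x, ext R (setv V p P) N a x].
Proof.
move=> AV ca pa cC HC.
have [|||x|P [AP CP] HP] := @compact_directed (set W)
    [set P | A P /\ C `<=` P] (fun P => sext R (setv V p P) N false a).
- by exists setT; split=> //; exact: (admissible_setT genA).
- by move=> P [AP _]; apply: tclosed_sext => //; exact: admissible_setv.
- move=> P Q [AP CP] [AQ CQ]; exists (P `&` Q).
    by split; [exact: (admissible_setI genA)|move=> u Cu; split; auto].
  by move=> u Hu; split; move: Hu; apply: sext_setv_mono => // v [].
- apply: contrapT => /forall2NP nH.
  have : sext R (setv V p C) N false a x; last by apply.
  apply: sext_intersection => // P AP CP.
  by have [[]|/contrapT] := nH P.
- by exists P; split=> // x; apply: contrapT; exact: HP.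
Qed.

End Topology.

(** * Soundness of the transformation rules *)

(* The diamond rule puts a nominal in positive position on the right of an
   implication, so its first conclusion is not syntactically open; but it
   contains no variable, and no rule can turn it into an equation with one. *)
Definition link (e : eqn) : bool :=
  match e with
  | EImp (Nom _) (Nom _) | EImp (Nom _) (Dia (Nom _)) => true
  | _ => false
  end.

Definition sys_open (S : system) : bool :=
  all (fun e => link e || closedf false (eqn_formula e)) S.

Lemma eqn_rule_open e es : eqn_rule e es ->
  link e || closedf false (eqn_formula e) -> sys_open es.
Proof.
move=> ees /orP[].
  (* No rule applies to a link: neither a nominal nor the diamond of a nominal contains a redex. *)
  case: e es / ees => [b c d|b c d|b c d|c d|c d|c|c|c|c|a a' b r|a b b' r|a a' r] //=.
  - by case: b.
  - by case: b.
  - by case: c.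
  - by case: c.
  - by case: a r => // j r; inversion r as [? ? q| | | | | | | | |]; inversion q.
  - case: a => // j; case: b r => // [k|c] r.
      by inversion r as [? ? q| | | | | | | | |]; inversion q.
    case: c r => // k r _; inversion r as [? ? q| | | | | |? ? q| | |].
      by inversion q.
    by inversion q as [? ? q'| | | | | | | | |]; inversion q'.
case: e es / ees => [b c d|b c d|b c d|c d|c d|c|c|c|c|a a' b r|a b b' r|a a' r] /=;
  rewrite ?andbT.
- by case/and3P=> -> -> ->; rewrite ?orbT.
- by case/and3P=> -> -> ->; rewrite ?orbT.
- by case/andP=> /andP[-> ->] ->; rewrite ?orbT.
- by case/andP=> -> ->; rewrite ?orbT.
- by case/andP=> -> ->; rewrite ?orbT.
- by move=> ->.
- by [].
- by [].
- by move=> ->.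
- by case/andP=> /(closedf_in_context closedf_aux r) -> ->; rewrite ?orbT.
- by case/andP=> -> /(closedf_in_context closedf_aux r) ->; rewrite ?orbT.
- by move/(closedf_in_context closedf_aux r) ->.
Qed.

Lemma sys_open_eqi S T : S =i T -> sys_open S = sys_open T.
Proof. by move=> ST; apply: eq_all_r. Qed.

Lemma closedf_bigOr s l : closedf s (bigOr l) = all (closedf s) l.
Proof.
elim: l => [|a [|b l] IH] //=; first by rewrite andbT.
by rewrite IH.
Qed.

Lemma closedf_premise a p :
  link (EImp a (Var p)) || closedf false (eqn_formula (EImp a (Var p))) ->
  closedf true a.
Proof. by have -> : link (EImp a (Var p)) = false; [case: a|rewrite /= andbT]. Qed.

Lemma sys_open_step S T : sqema_step S T -> sys_open S -> sys_open T.
Proof.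
case=> [e es ees [U [_ eS eT]]|j k c _ _ [U [_ eS eT]]|p al be eS nal npbe eT|p eT].
- rewrite (sys_open_eqi eS) (sys_open_eqi eT) /= => /andP[He HU].
  by rewrite /sys_open all_cat; apply/andP; split; first exact: eqn_rule_open ees He.
- rewrite (sys_open_eqi eS) (sys_open_eqi eT) /= => /andP[Hc ->].
  rewrite /= andbT.
  (* If the premise is itself a link, [c] is a nominal and the second conclusion links two nominals;
     otherwise [c] is open. *)
  by case: c Hc {eS eT} => // *; apply/orP; right.
- rewrite (sys_open_eqi eS) (sys_open_eqi eT) /sys_open all_cat all_map.
  move=> /andP[Hal Hbe]; apply/allP => _ /mapP[e eb ->].
  have /orP[Hl|He] := allP Hbe e eb.
    (* Links contain no variables, so the substitution leaves them links. *)
    apply/orP; left; move: Hl.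
    by case: e {eb} => // -[] // j [] // [].
  apply/orP; right.
  have cal : closedf true (bigOr al).
    rewrite closedf_bigOr; apply/allP => a aal.
    exact: closedf_premise (allP Hal a aal).
  have npe := allP npbe e eb.
  have -> : eqn_formula (eqn_map (subst (subst1 p (bigOr al))) e) =
            subst (subst1 p (bigOr al)) (eqn_formula e) by case: (e).
  apply: closedf_subst => // q; rewrite /subst1; case: eqP => // [->|_].
    by left.
  by right.
- rewrite (sys_open_eqi eT) /sys_open all_map => HS; apply: sub_all HS => e /=.
  case: e => [a b|a] /=; last by rewrite closedf_switch.
  rewrite !closedf_switch => /orP[|->]; last by rewrite orbT.
  by case: a => // j; case: b => // -[].
Qed.

(** * Invariance of satisfiability under the rules *)

Section Truth.
Variables (W : Type) (R : W -> W -> Prop).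
Implicit Types (V : nat -> set W) (N : nat -> W).

Definition sys_true V N (S : system) : Prop :=
  forall e x, e \in S -> ext R V N (eqn_formula e) x.

Lemma sys_true_eqi V N S T : S =i T -> sys_true V N S <-> sys_true V N T.
Proof. by move=> ST; split=> H e x eS; apply: H; rewrite ?ST // -ST. Qed.

Lemma sys_true_cat V N S T :
  sys_true V N (S ++ T) <-> sys_true V N S /\ sys_true V N T.
Proof.
split=> [H|[HS HT] e x].
  by split=> e x eS; apply: H; rewrite mem_cat eS ?orbT.
by rewrite mem_cat => /orP[/HS|/HT].
Qed.

Lemma sys_true1 V N e : sys_true V N [:: e] <-> ext R V N (eqn_formula e) = setT.
Proof.
split=> [H|H f x]; last by rewrite inE => /eqP ->; rewrite H.
by rewrite -subTset => x _; apply: H; rewrite mem_head.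
Qed.

Lemma sys_true_cons V N e S :
  sys_true V N (e :: S) <-> ext R V N (eqn_formula e) = setT /\ sys_true V N S.
Proof. by rewrite -cat1s sys_true_cat sys_true1. Qed.

Lemma ext_imp V N a b :
  ext R V N (eqn_formula (EImp a b)) = setT <-> ext R V N a `<=` ext R V N b.
Proof.
rewrite -subTset; split=> [H x ax|H x _] /=; first by have [] := H x I.
by have [/H|] := pselect (ext R V N a x); [right|left].
Qed.

Lemma diaset_conv_sub (X Y : set W) :
  (diaset (conv R) X `<=` Y) <-> (X `<=` boxset R Y).
Proof.
split=> [H x Xx y Rxy|H y [x Xx Rxy]]; last exact: (H x).
by apply: H; exists x.
Qed.

Lemma eqn_rule_true V N e es : eqn_rule e es ->
  ext R V N (eqn_formula e) = setT <-> sys_true V N es.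
Proof.
case=> [b c d|b c d|b c d|c d|c d|c|c|c|c|a a' b r|a b b' r|a a' r];
  rewrite ?sys_true1 ?sys_true_cons ?sys_true1 ?ext_imp /=.
- by rewrite subsetI; split=> [[bc bd]|[bc []]] //; do 2?split.
- split=> H x; first by case=> /H[].
  by move=> bx; have [|nc] := pselect (ext R V N c x); [left|right; apply: H].
- split=> H x; last by case=> /H[].
  by move=> bx; have [|nc] := pselect (ext R V N c x); [left|right; apply: H].
- by rewrite diaset_conv_sub.
- by rewrite diaset_conv_sub.
- rewrite subset0; split=> [->|H]; first exact: setC0.
  by rewrite -[ext _ _ _ _]setCK H setCT.
- by split=> // _ x.
- by split=> // _ x.
- by rewrite subTset.
- by rewrite (ext_in_context (@ext_aux _ R V N) r).
- by rewrite (ext_in_context (@ext_aux _ R V N) r).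
- by rewrite (ext_in_context (@ext_aux _ R V N) r).
Qed.

Lemma eq_sys_true V V' N N' S : (forall e, e \in S ->
    ext R V N (eqn_formula e) = ext R V' N' (eqn_formula e)) ->
  sys_true V N S <-> sys_true V' N' S.
Proof. by move=> H; split=> HS e x eS; [rewrite -H|rewrite H] => //; exact: HS. Qed.

Lemma sys_true_map V V' N (f : mlp -> mlp) S :
  (forall a, ext R V N (f a) = ext R V' N a) ->
  sys_true V N [seq eqn_map f e | e <- S] <-> sys_true V' N S.
Proof.
move=> Hf.
have He e : ext R V N (eqn_formula (eqn_map f e)) = ext R V' N (eqn_formula e).
  by case: e => * /=; rewrite !Hf.
split=> H e x; first by move=> eS; rewrite -He; apply: H; exact: map_f.
by case/mapP=> e' eS ->; rewrite He; exact: H.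
Qed.

Lemma sys_noms_ext V N N' k S e : k \notin sys_noms S -> e \in S ->
  (forall j, j != k -> N j = N' j) ->
  ext R V N (eqn_formula e) = ext R V N' (eqn_formula e).
Proof.
move=> kS eS NN; apply: eq_ext => // j je; apply: NN.
apply: contraNneq kS => <-; apply/flattenP.
by exists (noms (eqn_formula e)) => //; exact: map_f.
Qed.

Definition satisfiable (A : set (set W)) (w : W) (S : system) : Prop :=
  exists V N, [/\ forall p, A (V p), N inom = w & sys_true V N S].

Lemma sat_eqn A w S T e es : eqn_rule e es -> replace_eqn e es S T ->
  satisfiable A w S <-> satisfiable A w T.
Proof.
move=> ees [U [_ eS eT]].
suff H V N : sys_true V N S <-> sys_true V N T.
  by split=> -[V [N [AV Nw /H HS]]]; exists V, N.
rewrite (sys_true_eqi _ _ eS) (sys_true_eqi _ _ eT) sys_true_cons sys_true_cat.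
by rewrite (eqn_rule_true V N ees).
Qed.

Lemma sat_dia A w S T j k c : k != inom -> k \notin sys_noms S ->
  replace_eqn (EImp (Nom j) (Dia c))
    [:: EImp (Nom j) (Dia (Nom k)); EImp (Nom k) c] S T ->
  satisfiable A w S <-> satisfiable A w T.
Proof.
move=> ki kS [U [_ eS eT]]; split=> -[V [N [AV Nw]]].
  move=> HS; move: (HS); rewrite (sys_true_eqi _ _ eS) sys_true_cons ext_imp.
  move=> [/(_ (N j) erefl) [u cu Rju] HU].
  (* Being fresh and distinct from [inom], [k] can name the witness [u] without changing [S] or the
     value of the reserved nominal. *)
  pose N' i := if i == k then u else N i.
  have HN i : i != k -> N i = N' i by rewrite /N' => /negPf ->.
  exists V, N'; split=> //; first by rewrite -HN // eq_sym.
  have eN e : e \in S -> ext R V N (eqn_formula e) = ext R V N' (eqn_formula e).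
    by move=> eS'; exact: (sys_noms_ext V kS eS' HN).
  have [/HN Hj HNc] : j != k /\ ext R V N c = ext R V N' c.
    have Dia_S : EImp (Nom j) (Dia c) \in S by rewrite eS mem_head.
    have Hk i : i \in j :: noms c -> i != k.
      move=> Hi; apply: contraNneq kS => <-; apply/flattenP.
      by exists (j :: noms c) => //; apply/mapP; exists (EImp (Nom j) (Dia c)).
    split; first by apply: Hk; rewrite mem_head.
    by apply: eq_ext => // i ic; apply/HN/Hk; rewrite inE ic orbT.
  rewrite (sys_true_eqi _ _ eT) !sys_true_cons !ext_imp /=; split; last split.
  - by move=> _ ->; exists (N' k) => //; rewrite -Hj /N' eqxx.
  - by move=> _ ->; rewrite -HNc /N' eqxx.
  - by move=> e x eU; rewrite -eN; [exact: HU|rewrite eS inE eU orbT].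
rewrite (sys_true_eqi _ _ eT) !sys_true_cons !ext_imp /=.
move=> [Hjk [Hkc HU]]; exists V, N; split=> //.
rewrite (sys_true_eqi _ _ eS) sys_true_cons ext_imp; split=> // _ ->.
have [_ -> Rjk] := Hjk (N j) erefl.
by exists (N k) => //; exact: Hkc.
Qed.

(** Complementing the value of [p] is an involution on admissible valuations, so the same witness
    serves both directions. *)
Lemma sat_switch A w S T p : general_frame R A ->
  T =i [seq eqn_map (switch p) e | e <- S] ->
  satisfiable A w S <-> satisfiable A w T.
Proof.
move=> gA eT.
have Ac V : (forall q, A (V q)) -> forall q, A (complv V p q).
  by move=> AV q; rewrite /complv; case: ifP => _ //; exact: (admissible_setC gA).
have sw V N := sys_true_map S (ext_switch R V N p).
split=> -[V [N [AV Nw HS]]]; exists (complv V p), N; split=> //; try exact: Ac.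
  apply/(sys_true_eqi _ _ eT)/sw.
  suff -> : complv (complv V p) p = V by [].
  by apply/funext => q; rewrite /complv; case: eqP => // _; rewrite setCK.
by apply/sw/(sys_true_eqi _ _ eT).
Qed.

(** When all sets are admissible, [C] itself serves. Otherwise each equation gets its own superset
    of [C], and the supersets are intersected: the equations are negative in [p], so shrinking its
    value keeps them true. *)
Lemma ackermann_system A V N p C S :
  general_frame R A -> (forall X, A X) \/ descriptive R A /\ sys_open S ->
  (forall q, A (V q)) -> tclosed A C -> sys_polar false p S ->
  sys_true (setv V p C) N S ->
  exists P, [/\ A P, C `<=` P & sys_true (setv V p P) N S].
Proof.
move=> gA dA AV cC pS HS.
have [full|[[_ dif tig cpt] oS]] := dA; first by exists C; split.
elim: S {dA} oS pS HS => [|e S IH] /=.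
  by move=> _ _ _; exists setT; split=> //; exact: (admissible_setT gA).
move=> /andP[oe oS] /andP[pe pS] /sys_true_cons[He /(IH oS pS) [P [AP CP HP]]].
have [Q [AQ CQ HQ]] : exists Q, [/\ A Q, C `<=` Q &
    forall x, ext R (setv V p Q) N (eqn_formula e) x].
  case/orP: oe => [lk|oe]; last first.
    by apply: ackermann_formula => // x; rewrite He.
  (* A link has no variables, hence any value of [p] keeps it true. *)
  exists setT; split=> //; first exact: (admissible_setT gA).
  have <- : ext R (setv V p C) N (eqn_formula e) =
            ext R (setv V p setT) N (eqn_formula e).
    by apply: eq_ext => // q; case: e lk {pe He} => // -[] // j [] // [].
  by rewrite He.
have le X Y f : X `<=` Y -> polar false p f ->
    ext R (setv V p Y) N f `<=` ext R (setv V p X) N f.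
  move=> XY pf; apply: ext_mono => q; rewrite /setv.
  by case: eqP => [->|_]; split; auto; right.
exists (P `&` Q); split; first exact: (admissible_setI gA).
  by move=> x Cx; split; auto.
move=> f x; rewrite inE => /orP[/eqP ->|fS].
  by apply: (le _ Q); [move=> ? []|exact: pe|exact: HQ].
by apply: (le _ P); [move=> ? []|exact: (allP pS)|exact: HP].
Qed.

Lemma sat_ackermann A w S T p (alphas : seq mlp) (betas : system) :
  general_frame R A -> (forall X, A X) \/ descriptive R A /\ sys_open S ->
  S =i [seq EImp a (Var p) | a <- alphas] ++ betas ->
  all (fun a => p \notin pvars a) alphas ->
  sys_polar false p betas ->
  T =i [seq eqn_map (subst (subst1 p (bigOr alphas))) e | e <- betas] ->
  satisfiable A w S <-> satisfiable A w T.
Proof.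
move=> gA dA eS nal pbe eT.
have al V N X : (forall a, a \in alphas -> ext R (setv V p X) N a = ext R V N a).
  move=> a aal; apply: eq_ext => // q qa; rewrite /setv; case: eqP => // eqp.
  by move: (allP nal a aal); rewrite -eqp qa.
have alS V N X : sys_true (setv V p X) N [seq EImp a (Var p) | a <- alphas] <->
    ext R V N (bigOr alphas) `<=` X.
  split=> [H x /ext_bigOr [a aal ax]|H _ x /mapP[a aal ->]].
    have := H (EImp a (Var p)) x (map_f _ aal).
    by rewrite /= al // /setv eqxx => -[].
  rewrite /= al // /setv eqxx.
  have [ax|] := pselect (ext R V N a x); [right|by left].
  by apply: H; apply/ext_bigOr; exists a.
have sub V N : sys_true V N [seq eqn_map (subst (subst1 p (bigOr alphas))) e | e <- betas]
    <-> sys_true (setv V p (ext R V N (bigOr alphas))) N betas.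
  apply: sys_true_map => a; rewrite ext_subst; congr (ext R _ N a).
  by apply/funext => q; rewrite /subst1 /setv; case: eqP.
split=> -[V [N [AV Nw]]].
  (* The premises force [V p] to contain the minimal value; lowering [p] to it keeps the negative
     [betas] true. *)
  have {1}-> : V = setv V p (V p).
    by apply/funext => q; rewrite /setv; case: eqP => // ->.
  rewrite (sys_true_eqi _ _ eS) sys_true_cat alS => -[leV HB].
  exists V, N; split=> //; apply/(sys_true_eqi _ _ eT)/sub => e x eb.
  have := HB e x eb; apply: ext_mono => q; rewrite /setv.
  case: eqP => [->|_]; last by split; right.
  by split; [left; exact: (allP pbe)|right].
rewrite (sys_true_eqi _ _ eT) sub => HB.
have cC : tclosed A (ext R V N (bigOr alphas)).
  case: dA => [full|[[_ dif tig cpt]]]; first exact: tclosed_admissible.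
  rewrite (sys_open_eqi eS) /sys_open all_cat all_map => /andP[Hal _].
  rewrite -[ext _ _ _ _]/(sext R V N true (bigOr alphas)).
  apply: tclosed_sext => //; rewrite closedf_bigOr; apply/allP => a aal.
  exact: closedf_premise (allP Hal a aal).
have dB : (forall X, A X) \/ descriptive R A /\ sys_open betas.
  case: dA => [|[dA]]; first by left.
  by rewrite (sys_open_eqi eS) /sys_open all_cat => /andP[_]; right.
(* The admissible [P] replaces the minimal value: containing it, [P] still satisfies the
   premises. *)
have [P [AP CP HP]] := ackermann_system gA dB AV cC pbe HB.
exists (setv V p P), N; split=> //; first exact: admissible_setv.
by rewrite (sys_true_eqi _ _ eS) sys_true_cat alS.
Qed.

Lemma sat_step A w S T : general_frame R A ->
  (forall X, A X) \/ descriptive R A /\ sys_open S -> sqema_step S T ->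
  satisfiable A w S <-> satisfiable A w T.
Proof.
move=> gA dA [e es|j k c|p al be|p].
- exact: sat_eqn.
- exact: sat_dia.
- exact: sat_ackermann.
- exact: sat_switch.
Qed.

Lemma sat_steps A w S T : general_frame R A ->
  (forall X, A X) \/ descriptive R A -> sys_open S ->
  clos_refl_trans system sqema_step S T ->
  satisfiable A w S <-> satisfiable A w T.
Proof.
move=> gA dA oS ST.
suff [] : sys_open T /\ (satisfiable A w S <-> satisfiable A w T) by [].
elim: {S T} ST oS => [S T ST|S|S T U _ IH _ IH'] oS //.
  split; first exact: sys_open_step ST oS.
  by apply: sat_step => //; case: dA; [left|right].
by have [oT ->] := IH oS; exact: IH'.
Qed.

(** Interpreting each variable by its substitute gives an admissible valuation for [S]. Conversely,
    raising positive variables to [Top] and lowering negative ones to [Bot] preserves truth. *)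
Lemma sat_monotone_elim A w S : general_frame R A ->
  satisfiable A w (monotone_elim S) <-> satisfiable A w S.
Proof.
move=> gA; rewrite /monotone_elim; set f := (fun p : nat => if _ then _ else _).
have sub V N := sys_true_map S (ext_subst R V N f).
split=> -[V [N [AV Nw HS]]].
  exists (fun p => ext R V N (f p)), N; split=> //; last exact/sub.
  have AT := admissible_setT gA.
  move=> p; rewrite /f; case: ifP => // _; case: ifP => //= _.
  by rewrite -setCT; exact: (admissible_setC gA).
exists V, N; split=> //; apply/sub => e x eS; move: (HS e x eS).
apply: ext_mono => p; rewrite /f; case: ifP => [/allP/(_ e eS) pe|_].
  by split; [right|left].
case: ifP => [/allP/(_ e eS) pe|_]; first by split; [left|right].
by split; right.
Qed.

Lemma sat_init A w a : general_frame R A -> noms a = [::] ->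
  satisfiable A w [:: EImp (Nom inom) a] <->
  exists2 V, (forall p, A (V p)) & ext R V (fun=> w) a w.
Proof.
move=> gA na.
have eN V N : ext R V N a = ext R V (fun=> w) a by apply: eq_ext => // j; rewrite na.
split=> [[V [N [AV Nw]]]|[V AV aw]].
  rewrite sys_true1 ext_imp eN => H; exists V => //.
  by apply: H; rewrite /= Nw.
exists V, (fun=> w); split=> //.
by rewrite sys_true1 ext_imp => _ ->.
Qed.

(** The constant valuation is a placeholder; with it the right-hand side is the same for every
    choice of [A]. *)
Lemma sat_pure A w S : general_frame R A -> sys_pvars S = [::] ->
  satisfiable A w S <->
  exists2 N, N inom = w & sys_true (fun=> setT) N S.
Proof.
move=> gA S0.
have eV V V' N : sys_true V N S -> sys_true V' N S.
  have := @eq_sys_true V V' N N S; case=> // e eS; apply: eq_ext => // p pe.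
  suff : p \in sys_pvars S by rewrite S0.
  by apply/flattenP; exists (pvars (eqn_formula e)) => //; exact: map_f.
split=> [[V [N [_ Nw /eV HS]]]|[N Nw HS]]; first by exists N.
by exists (fun=> setT), N; split=> // p; exact: (admissible_setT gA).
Qed.

End Truth.

(** * Runs of the algorithm *)

(** A nominal is closed but never open, and an inverse modality never has both signs. Preprocessed
    formulae have both signs, so nominals need not be tracked through preprocessing. *)
Lemma closedf_noms a : closedf true a -> closedf false a -> noms a = [::].
Proof.
elim: a => //= [a IH|a IHa b IHb|a IHa b IHb] H1 H2; first exact: IH.
  by case/andP: H1 H2 => a1 b1 /andP[a2 b2]; rewrite IHa ?IHb.
by case/andP: H1 H2 => a1 b1 /andP[a2 b2]; rewrite IHa ?IHb.
Qed.

Lemma closedf_nnf s t phi : closedf s (nnf t (embed phi)).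
Proof.
elim: phi t => //= [||p|a IHa b IHb|a IHa b IHb|a IH|a IH] t;
  by case: t; rewrite /= ?IHa ?IHb.
Qed.

Lemma closedf_dist s a b : dist_rule a b -> closedf s a -> closedf s b.
Proof.
case=> [//|x y z|x y z] /=; first by case/andP=> /andP[-> ->] ->.
by case/and3P=> -> -> ->.
Qed.

Lemma closedf_disjuncts s a b : closedf s a -> b \in disjuncts a -> closedf s b.
Proof.
elim: a => [||p|j|a _|a _ c _|a IHa c IHc|a _|a _|a _|a _] Ha;
  try by rewrite inE => /eqP ->.
by move: Ha => /= /andP[Ha Hc]; rewrite mem_cat => /orP[/(IHa Ha)|/(IHc Hc)].
Qed.

Lemma preprocess_closedf phi alphas s a : preprocess phi alphas ->
  a \in alphas -> closedf s a.
Proof.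
move=> [psi [steps _ ->]]; apply: closedf_disjuncts.
have : closedf s (nnf true (Neg (embed phi))) by exact: closedf_nnf.
elim: steps => // [x y xy|x y z _ IH _ IH' /IH /IH' //].
exact: closedf_in_context (@closedf_dist) _ _ _ xy.
Qed.

Lemma preprocess_ext W (R : W -> W -> Prop) V N phi alphas w :
  preprocess phi alphas ->
  ~ truth R V phi w <-> exists2 a, a \in alphas & ext R V N a w.
Proof.
move=> [psi [steps _ ->]]; rewrite -ext_disjuncts.
have <- : ext R V N (nnf true (Neg (embed phi))) = ext R V N psi.
  elim: steps => // [x y xy|x y z _ -> _ -> //].
  exact: ext_in_context (@ext_dist _ R V N) _ _ xy.
by rewrite ext_nnf /sext /= ext_embed.
Qed.

Lemma Forall2_mem (X Y : eqType) (r : X -> Y -> Prop) (P : X -> Prop)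
    (Q : Y -> Prop) s t :
  List.Forall2 r s t -> (forall x y, x \in s -> r x y -> P x <-> Q y) ->
  (exists2 x, x \in s & P x) <-> (exists2 y, y \in t & Q y).
Proof.
elim=> {s t} [|x y s t rxy _ IH] PQ; first by split=> -[].
have {}IH : (exists2 x, x \in s & P x) <-> (exists2 y, y \in t & Q y).
  by apply: IH => x' y' xs; apply: PQ; rewrite inE xs orbT.
have {}PQ := PQ x y (mem_head _ _) rxy.
have split_ex (Z : eqType) (p : Z -> Prop) z u :
    (exists2 z', z' \in z :: u & p z') <-> p z \/ exists2 z', z' \in u & p z'.
  split=> [[z']|[pz|[z' zu pz]]].
  - by rewrite inE => /orP[/eqP ->|zu pz]; [left|right; exists z'].
  - by exists z; rewrite ?mem_head.
  - by exists z' => //; rewrite inE zu orbT.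
by rewrite !split_ex PQ IH.
Qed.

(** A refuting valuation makes some disjunct true at [w], and the run for this disjunct carries
    satisfiability to its final system and back. *)
Lemma forces_finals W (R : W -> W -> Prop) A w phi finals :
  general_frame R A -> (forall X, A X) \/ descriptive R A ->
  successful_execution phi finals ->
  gframe_forces R A w phi <->
  ~ exists2 T, T \in finals &
      exists2 N, N inom = w & sys_true R (fun=> setT) N T.
Proof.
move=> gA dA [alphas [pre runs]].
rewrite -(Forall2_mem (P := fun a => exists2 V, (forall p, A (V p)) &
  ext R V (fun=> w) a w) runs); last first.
  move=> a T aal [steps T0].
  have ca s : closedf s a by exact: preprocess_closedf pre aal.
  rewrite -(sat_init w gA (closedf_noms (ca true) (ca false))).
  rewrite -(sat_pure w gA T0) -(sat_steps w gA dA _ steps) ?sat_monotone_elim //.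
  rewrite /monotone_elim /sys_open /= andbT; apply/orP; right.
  rewrite closedf_subst //= => [p|p]; do ?case: ifP => // _; by right.
split=> [H [a aal [V AV aw]]|H V AV].
  suff : ~ truth R V phi w by apply; exact: H.
  by rewrite (preprocess_ext _ _ (fun=> w) _ pre); exists a.
apply: contrapT; rewrite (preprocess_ext _ _ (fun=> w) _ pre) => -[a aal aw].
by apply: H; exists a => //; exists V.
Qed.

Lemma general_frame_full W (R : W -> W -> Prop) : general_frame R setT.
Proof. by []. Qed.

(** A Kripke frame is the general frame with all sets admissible, so the criterion is the one found
    for descriptive frames; comparing the two gives d-persistence. *)
Lemma kframe_forces_finals W (R : W -> W -> Prop) w phi finals :
  successful_execution phi finals ->
  kframe_forces R w phi <->
  ~ exists2 T, T \in finals &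
      exists2 N, N inom = w & sys_true R (fun=> setT) N T.
Proof.
move=> ex; rewrite -(forces_finals w (general_frame_full R) (or_introl (fun=> I)) ex).
by split=> [H V _|H V]; apply: H.
Qed.

Lemma sqema_locally_d_persistent phi : sqema_succeeds phi -> locally_d_persistent phi.
Proof.
move=> [finals ex] W R A dA w.
rewrite (forces_finals w _ (or_intror dA) ex); last by case: dA.
by rewrite (kframe_forces_finals R w ex).
Qed.

(** * First-order output *)

Lemma pvars_pure S : pvars (pure S) = sys_pvars S.
Proof.
rewrite /sys_pvars /pure; elim: S => [|e [|f S] IH] //=; first by rewrite cats0.
by rewrite /= in IH; rewrite IH.
Qed.

Section StandardTranslation.
Variables (W : Type) (R : W -> W -> Prop).

Lemma sat_ST (V : nat -> set W) a n (e : fovar -> W) :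
  sat R V e (ST a n) <-> ext R V (fun j => e (y_ j)) a (e (x_ n)).
Proof.
have upd (f : fovar -> W) m u : update f (x_ m.+1) u (x_ m) = f (x_ m).
  by rewrite /update; case: eqP => // -[/n_Sn].
have upd' (f : fovar -> W) m u : update f (x_ m) u (x_ m) = u.
  by rewrite /update eqxx.
elim: a n e => [||p|j|a IH|a IHa b IHb|a IHa b IHb|a IH|a IH|a IH|a IH] n e //=.
- by rewrite IH.
- by rewrite IHa IHb.
- by rewrite IHa IHb.
- split=> [[u]|[u au Ru]]; last exists u; rewrite IH !upd upd' //.
  by case=> Ru au; exists u.
- split=> H u; first by move=> Ru; have := H u; rewrite IH !upd upd'; apply.
  by rewrite IH !upd upd'; exact: H.
- split=> [[u]|[u au Ru]]; last exists u; rewrite IH !upd upd' //.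
  by case=> Ru au; exists u.
- split=> H u; first by move=> Ru; have := H u; rewrite IH !upd upd'; apply.
  by rewrite IH !upd upd'; exact: H.
Qed.

Lemma sat_foldr_FAll (V : nat -> set W) js f e :
  sat R V e (foldr (fun j f => FAll (y_ j) f) f js) <->
  forall e', (forall z, z \notin [seq y_ j | j <- js] -> e' z = e z) ->
    sat R V e' f.
Proof.
elim: js e => [|j js IH] e /=.
  split=> [H e' He|]; last by apply.
  by have -> : e' = e by apply/funext => z; exact: He.
split=> [H e' He|H u].
  have /IH := H (e' (y_ j)); apply=> z zjs; rewrite /update.
  by case: eqP => [->|/eqP zj] //; apply: He; rewrite inE negb_or zj.
apply/IH => e' He; apply: H => z; rewrite inE negb_or => /andP[zj zjs].
by rewrite He // /update (negPf zj).
Qed.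

Lemma sat_sys_output (V : nat -> set W) (e : fovar -> W) S :
  sys_pvars S = [::] ->
  sat R V e (sys_output S) <->
  ~ exists2 N, N inom = e (y_ inom) & sys_true R (fun=> setT) N S.
Proof.
move=> S0; rewrite /sys_output sat_foldr_FAll.
set js := [seq j <- _ | _].
have pureE N : sys_true R (fun=> setT) N S <-> forall x, ext R V N (pure S) x.
  have -> : ext R V N (pure S) = ext R (fun=> setT) N (pure S).
    by apply: eq_ext => // p; rewrite pvars_pure S0.
  split=> [H x|H x y xS]; last first.
    by have /ext_bigAnd := H y; apply; exact: map_f.
  by apply/ext_bigAnd => _ /mapP[y yS ->]; exact: H.
split=> [H [N N0 /pureE HN]|H e' He].
  (* The quantified variables take the values given by [N]. The only nominal left out is [inom],
     where [N] and [e] agree. *)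
  pose e' z := if z is inr j then (if j \in js then N j else e z) else e z.
  have [x] : exists x, sat R V (update e' (x_ 0) x) (ST (Neg (pure S)) 0).
    apply: H => -[n|j] // jjs; rewrite /e'; case: ifP => // jin.
    by move: jjs; rewrite map_f.
  rewrite sat_ST /=; apply.
  have <- : ext R V N (pure S) =
      ext R V (fun j => update e' (x_ 0) x (y_ j)) (pure S).
    apply: eq_ext => // j jS; rewrite /update /= mem_filter mem_undup jS andbT.
    by case: eqP => // ->; rewrite N0.
  exact: HN.
(* If no point refutes [pure S] under [e'], then [e'] itself supplies the assignment of the
   nominals. *)
apply: contrapT => nx; apply: H; exists (fun j => e' (y_ j)).
  by apply: He; apply/mapP => -[j]; rewrite mem_filter => /andP[/eqP jn _] [/esym].
apply/pureE => x; apply: contrapT => nS; apply: nx; exists x.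
by apply/sat_ST; rewrite /= /update eqxx.
Qed.

Lemma free_vars_ST a n :
  {subset free_vars (ST a n) <= x_ n :: [seq y_ j | j <- noms a]}.
Proof.
have cat k b c z : {subset free_vars (ST b k) <= x_ k :: [seq y_ j | j <- noms b]} ->
    {subset free_vars (ST c k) <= x_ k :: [seq y_ j | j <- noms c]} ->
    z \in free_vars (ST b k) ++ free_vars (ST c k) ->
    z \in x_ k :: [seq y_ j | j <- noms b ++ noms c].
  move=> Hb Hc; rewrite map_cat inE !mem_cat => /orP[/Hb|/Hc];
    by rewrite inE => /orP[->|->]; rewrite ?orbT.
(* The two orientations of the relational atom cover the forward and the inverse modalities. *)
have quant k m x y f s z : {subset free_vars f <= x_ m :: s} ->
    z \in [seq u <- [:: x; y] ++ free_vars f | u != x_ m] ->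
    x = x_ k /\ y = x_ m \/ x = x_ m /\ y = x_ k -> z \in x_ k :: s.
  move=> H; rewrite mem_filter mem_cat !inE => /andP[zm] /orP[zxy xy|/H + _].
    by case: xy zxy => -[-> ->]; rewrite (negPf zm) ?orbF /= => ->.
  by rewrite inE (negPf zm) /= => ->; rewrite orbT.
elim: a n => [||p|j|a IH|a IHa b IHb|a IHa b IHb|a IH|a IH|a IH|a IH] n z.
- by [].
- by [].
- by [].
- by [].
- exact: IH.
- exact: cat.
- exact: cat.
- by move/(quant n n.+1); apply; [exact: IH|left].
- by move/(quant n n.+1); apply; [exact: IH|left].
- by move/(quant n n.+1); apply; [exact: IH|right].
- by move/(quant n n.+1); apply; [exact: IH|right].
Qed.

Lemma frame_language_ST a n : pvars a = [::] -> frame_language (ST a n).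
Proof.
elim: a n => //= [a IHa b IHb|a IHa b IHb|a IH|a IH|a IH|a IH] n H;
  rewrite ?IHa ?IHb ?IH //; by case: (pvars a) H.
Qed.

Lemma frame_language_sys_output S :
  sys_pvars S = [::] -> frame_language (sys_output S).
Proof.
rewrite -pvars_pure => S0; rewrite /sys_output; elim: [seq _ <- _ | _] => //=.
exact: frame_language_ST.
Qed.

Lemma free_vars_sys_output S :
  {subset free_vars (sys_output S) <= [:: y_ inom]}.
Proof.
rewrite /sys_output.
have foldr_free js f :
    free_vars (foldr (fun j f => FAll (y_ j) f) f js) =i
    [seq z <- free_vars f | z \notin [seq y_ j | j <- js]].
  elim: js => [|j js IH] z /=; first by rewrite filter_predT.
  by rewrite !mem_filter IH mem_filter inE negb_or andbA.
move=> z; rewrite foldr_free mem_filter /= mem_filter.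
case/and3P=> zjs z0 /free_vars_ST; rewrite inE (negPf z0) /=.
case/mapP=> j jS ejz; rewrite inE ejz; apply: contraNT zjs => jn.
rewrite ejz map_f // mem_filter mem_undup jS andbT.
by apply: contraNneq jn => ->.
Qed.
End StandardTranslation.

Lemma sqema_local_fo_equivalent phi finals :
  successful_execution phi finals ->
  local_fo_equivalent phi (sqema_output finals).
Proof.
move=> ex.
have S0 T : T \in finals -> sys_pvars T = [::].
  case: ex => alphas [_]; elim=> {alphas finals} // a U alphas finals [_ U0] _ IH.
  by rewrite inE => /orP[/eqP ->|/IH].
rewrite /sqema_output; split.
- elim: finals {ex} S0 => //= T finals IH S0.
  rewrite frame_language_sys_output ?IH // => [U UT|]; apply: S0.
    by rewrite inE UT orbT.
  by rewrite mem_head.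
- move=> z; elim: finals {ex S0} => //= T finals IH.
  by rewrite mem_cat => /orP[/free_vars_sys_output|/IH].
move=> W R w V e <-; rewrite (kframe_forces_finals R _ ex).
elim: finals S0 {ex} => [|T finals IH] S0 /=; first by split=> // _ [].
rewrite sat_sys_output; last by apply: S0; rewrite mem_head.
rewrite -IH => [|U UT]; last by apply: S0; rewrite inE UT orbT.
split=> [H|[HT Hf] [U]].
  by split=> [HT|[U UT HU]]; apply: H; [exists T|exists U]; rewrite // inE ?eqxx // UT orbT.
by rewrite inE => /orP[/eqP ->|UT HU] //; apply: Hf; exists U.
Qed.

(** * Canonical frames *)

Section Canonical.
Variables (L : set ml) (nL : normal_modal_logic L).

(** Nested implications express derivability of [c] from the list [s], and suit list induction
    better than indexed conjunctions. *)
Definition MImps (s : seq ml) (c : ml) : ml := foldr MImp c s.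

Lemma bool_eval_MImps v s c :
  bool_eval v (MImps s c) = all (bool_eval v) s ==> bool_eval v c.
Proof. by elim: s => //= a s ->; case: (bool_eval v a). Qed.

Lemma nml_taut_imp a b : (forall v, bool_eval v a ==> bool_eval v b) -> L a -> L b.
Proof. by move=> H; apply: (nml_mp nL); apply: (nml_taut nL) => v; rewrite /MImp /= -implybE. Qed.

Lemma bool_eval_bigand v n (f : 'I_n -> ml) :
  bool_eval v (\big[MAnd/MTop]_(k < n) f k) = all (bool_eval v) (map f (enum 'I_n)).
Proof.
rewrite (big_morph (bool_eval v) (id1 := true) (op1 := andb)) // big_all.
by rewrite all_map enumT; apply: eq_all.
Qed.

Lemma consistentE G :
  consistent L G <->
  forall s, List.Forall G s -> ~ L (MImps s MBot).
Proof.
split=> [H s Gs Ls|H n f Gf Lf].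
  have Gn k : k < size s -> G (nth MTop s k).
    elim: Gs k => {Ls} // a s' Ga _ IH [|k] //=; exact: IH.
  apply: (H (size s) (fun k => nth MTop s k)) => [k|]; first exact: Gn.
  apply: nml_taut_imp Ls => v; rewrite bool_eval_MImps /= bool_eval_bigand.
  rewrite implybF -{1}(mkseq_nth MTop s) /mkseq -val_enum_ord -map_comp.
  exact: implybb.
apply: (H (map f (enum 'I_n))).
  by elim: (enum 'I_n) => //= *; constructor.
apply: nml_taut_imp Lf => v; rewrite bool_eval_MImps /= bool_eval_bigand.
by rewrite implybF implybb.
Qed.

Lemma lindenbaum G : consistent L G ->
  exists H : canonical_world L, G `<=` sval H.
Proof.
move=> cG.
(* Zorn's lemma is applied to the sets to be added to [G], not to its supersets, so that the empty
   chain also has a bound. *)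
have [F totF chain|M [cM maxM]] := @Zorn_bigcup ml [set X | consistent L (G `|` X)].
  apply/consistentE => s Hs.
  (* A finite list from the union of a chain already lies in one member, or in [G] alone. *)
  suff [Gs|[X FX GXs]] : List.Forall G s \/
      exists2 X, F X & List.Forall (G `|` X) s.
  - by have /consistentE := cG; apply.
  - by have /consistentE := totF X FX; apply.
  elim: Hs => [|a {}s [Ga|[X FX Xa]] _ [Gs|[Y FY Ys]]].
  - by left.
  - by left; constructor.
  - right; exists Y => //; constructor=> //; by left.
  - right; exists X => //; constructor; first by right.
    by apply: List.Forall_impl Gs => b; left.
  - have [XY|YX] := chain _ _ FX FY; right.
      by exists Y => //; constructor=> //; right; exact: XY.
    exists X => //; constructor; first by right.
    by apply: List.Forall_impl Ys => b [Gb|/YX Xb]; [left|right].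
have mM : maximal_consistent L (G `|` M).
  split=> // H cH GMH a Ha; apply: contrapT => nGMa.
  apply: (maxM H) => /=.
    by split=> [b Mb|HM]; [apply: GMH; right|apply: nGMa; right; exact: HM].
  suff -> : G `|` H = H by [].
  by apply/setUidPr => b Gb; apply: GMH; left.
by exists (exist _ _ mM) => a Ga; left.
Qed.

(** A form of the deduction theorem: the copies of [c] are removed from an inconsistent list and
    discharged as one negated conclusion. *)
Lemma inconsistent_add G c : ~ consistent L (G `|` [set c]) ->
  exists2 s, List.Forall G s & L (MImps s (MNeg c)).
Proof.
move/consistentE/existsNP => [t /not_implyP[Ht /contrapT Lt]].
suff [s Gs Hs] : exists2 s, List.Forall G s & forall v,
    all (bool_eval v) s && bool_eval v c ==> all (bool_eval v) t.
  exists s => //; apply: nml_taut_imp Lt => v; rewrite !bool_eval_MImps /=.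
  by move: (Hs v); do !case: all; case: bool_eval.
elim: Ht {Lt} => [|a {}t GCa _ [s Gs Hs]]; first by exists [::] => [|v]; [constructor|exact: implybT].
case: GCa => [Ga|->].
  exists (a :: s); first by constructor.
  by move=> v; move: (Hs v) => /=; case: (bool_eval v a).
exists s => // v; move: (Hs v) => /=.
by case: (bool_eval v c); rewrite ?andbF.
Qed.

(** * Closure properties of maximal consistent sets *)

Section World.
Variable H : canonical_world L.

Lemma world_consistent : consistent L (sval H).
Proof. by case: (svalP H). Qed.

Lemma world_add c :
  (forall s, List.Forall (sval H) s -> ~ L (MImps s (MNeg c))) -> sval H c.
Proof.
move=> Hc; have [_ maxH] := svalP H.
apply: (maxH (sval H `|` [set c])); [|by left|by right].
by apply: contrapT => /inconsistent_add[s /Hc].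
Qed.

Lemma world_MImps s c : List.Forall (sval H) s -> L (MImps s c) -> sval H c.
Proof.
move=> Hs Ls; apply: world_add => t Ht Lt.
have /consistentE cH := world_consistent; apply: (cH (s ++ t)).
  by apply/List.Forall_app.
apply: (nml_mp nL) Lt; apply: nml_taut_imp Ls => v.
rewrite /MImp /= !bool_eval_MImps /= all_cat.
by do !case: all; case: bool_eval.
Qed.

Lemma world_L a : L a -> sval H a.
Proof. by move=> La; apply: (@world_MImps [::]). Qed.

Lemma world_taut s c : List.Forall (sval H) s ->
  (forall v, all (bool_eval v) s ==> bool_eval v c) -> sval H c.
Proof.
move=> Hs sc; apply: (world_MImps Hs); apply: (nml_taut nL) => v.
by rewrite bool_eval_MImps.
Qed.

Lemma world_mp a b : sval H (MImp a b) -> sval H a -> sval H b.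
Proof.
move=> Hab Ha; apply: (@world_taut [:: MImp a b; a]); first by do !constructor.
by move=> v /=; case: (bool_eval v a); case: (bool_eval v b).
Qed.

Lemma world_neg a : sval H (MNeg a) <-> ~ sval H a.
Proof.
split=> [Hna Ha|nHa].
  have /consistentE cH := world_consistent; apply: (cH [:: MNeg a; a]).
    by do !constructor.
  by apply: (nml_taut nL) => v /=; case: (bool_eval v a).
have [_ maxH] := svalP H.
have /inconsistent_add[s Hs Ls] : ~ consistent L (sval H `|` [set a]).
  by move=> ca; apply: nHa; apply: (maxH _ ca); [left|right].
exact: world_MImps Hs Ls.
Qed.

Lemma world_and a b : sval H (MAnd a b) <-> sval H a /\ sval H b.
Proof.
split=> [Hab|[Ha Hb]]; last first.
  apply: (@world_taut [:: a; b]) => [|v /=]; first by do !constructor.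
  by rewrite andbT implybb.
by split; (apply: (@world_taut [:: MAnd a b]) => [|v /=]; [by do !constructor|]);
  case: (bool_eval v a); case: (bool_eval v b).
Qed.

Lemma world_or a b : sval H (MOr a b) <-> sval H a \/ sval H b.
Proof.
split=> [Hab|].
  apply: contrapT => /not_orP[/world_neg Ha /world_neg Hb].
  have /world_neg : sval H (MNeg (MOr a b)); last by [].
  apply: (@world_taut [:: MNeg a; MNeg b]) => [|v /=]; first by do !constructor.
  by case: (bool_eval v a); case: (bool_eval v b).
case=> Hx; [apply: (@world_taut [:: a])|apply: (@world_taut [:: b])];
  rewrite //=; try (by do !constructor); move=> v;
  by case: (bool_eval v a); case: (bool_eval v b).
Qed.

(** Necessitation boxes the whole chain of implications, and axiom K then detaches its premises one
    by one. *)
Lemma world_box_MImps s c : List.Forall (fun b => sval H (MBox b)) s ->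
  L (MImps s c) -> sval H (MBox c).
Proof.
move=> Hs /(nml_nec nL) /world_L; elim: Hs => //= b {}s Hb _ IH Hbs; apply: IH.
by apply: world_mp Hb; apply: world_mp Hbs; apply: world_L; exact: (nml_K nL).
Qed.

End World.

(** The existence lemma: if [MBox a] is missing, the formulae boxed in [H] are consistent with
    [MNeg a], and a maximal extension is a successor refuting [a]. *)
Lemma world_box (H : canonical_world L) a :
  sval H (MBox a) <-> forall K, canonical_rel H K -> sval K a.
Proof.
split=> [Ha K|Ha]; first exact.
apply: contrapT => nHa.
have [|K GK] := @lindenbaum ([set b | sval H (MBox b)] `|` [set MNeg a]).
  apply: contrapT => /inconsistent_add[s Hs Ls]; apply: nHa.
  apply: (world_box_MImps Hs); apply: nml_taut_imp Ls => v.
  by rewrite !bool_eval_MImps /= negbK implybb.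
have /world_neg nKa : sval K (MNeg a) by apply: GK; right.
by apply: nKa; apply: Ha => b Hb; apply: GK; left.
Qed.

Lemma world_dia (H : canonical_world L) a :
  sval H (MDia a) <-> exists K : canonical_world L, canonical_rel H K /\ sval K a.
Proof.
split=> [Ha|[K [HK Ka]]].
  have /world_neg : sval H (MNeg (MBox (MNeg a))).
    by apply: world_mp Ha; apply: world_L; exact: (nml_dual1 nL).
  move=> nHa; apply: contrapT => nK; apply: nHa.
  apply/world_box => K HK; apply/world_neg => Ka; apply: nK.
  by exists K.
apply: (world_mp (world_L H (nml_dual2 nL a))).
by apply/world_neg => /world_box /(_ K HK) /world_neg.
Qed.

Lemma world_inj (H K : canonical_world L) : sval H = sval K -> H = K.
Proof. by case: H K => [G mG] [G' mG'] /=; exact: eq_exist. Qed.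

Definition worlds (a : ml) : set (canonical_world L) := [set H | sval H a].

(** The truth lemma for all admissible valuations at once: each amounts to a substitution [s]. *)
Lemma truth_worlds s phi :
  truth (@canonical_rel L) (fun p => worlds (s p)) phi = worlds (msubst s phi).
Proof.
elim: phi => [||p|a IH|a IHa b IHb|a IHa b IHb|a IH|a IH] /=;
  rewrite ?IH ?IHa ?IHb; apply/funext => H; apply/propext.
- by split=> // _; apply: world_L; exact: (nml_taut nL).
- split=> // HB; have /world_neg : sval H (MNeg MBot); last by [].
  by apply: world_L; exact: (nml_taut nL).
- by [].
- by rewrite /worlds /= world_neg.
- by rewrite /worlds /= world_and.
- by rewrite /worlds /= world_or.
- by rewrite /worlds /= world_dia.
- by rewrite /worlds /= world_box.
Qed.

Lemma worlds_neg a : ~` worlds a = worlds (MNeg a).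
Proof. by apply/seteqP; split=> H /= /world_neg. Qed.

Lemma canonical_descriptive : descriptive (@canonical_rel L) (range worlds).
Proof.
split.
- split.
  + exists MTop => //; apply/seteqP; split=> // H _.
    by apply: world_L; exact: (nml_taut nL).
  + by move=> _ [a _ <-]; exists (MNeg a) => //; rewrite worlds_neg.
  + move=> _ _ [a _ <-] [b _ <-]; exists (MAnd a b) => //.
    by apply/seteqP; split=> H /= /world_and.
  + move=> _ [a _ <-]; exists (MDia a) => //; apply/seteqP; split=> H /=.
      by case/world_dia=> K [HK Ka]; exists K.
    by case=> K Ka HK; apply/world_dia; exists K.
- move=> H K nHK; apply: contrapT => same; apply: nHK.
  (* One inclusion suffices, since each world decides every formula. *)
  have HK a : sval H a -> sval K a.
    move=> Ha; apply: contrapT => nKa; apply: same.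
    by exists (worlds a); split=> //; exists a.
  apply: world_inj; apply/seteqP; split=> // a Ka; apply: contrapT.
  by move=> /world_neg /HK /world_neg.
- move=> H K; split=> [HK Y [_ YK]|HK a Ha]; first by exists K.
  apply: contrapT => /world_neg nKa.
  (* Tightness is tested on [worlds (MNeg a)]: the successor found there would contain both [a] and
     its negation. *)
  have [|J Ja HJ] := HK (worlds (MNeg a)); first by split=> //; exists (MNeg a).
  by move: Ja => /world_neg; apply; exact: HJ.
- move=> F FA fip.
  (* The finite intersection property makes the formulae naming members of [F] consistent; a world
     containing them all is the common point. *)
  have [|H GH] := @lindenbaum [set a | F (worlds a)].
    move=> n f Ff Lf; have [H Hf] := fip n (fun k => worlds (f k)) Ff.
    exact: (world_consistent (H := H) Hf Lf).
  by exists H => X FX; have [a _ eX] := FA X FX; rewrite -eX; apply: GH; rewrite /= eX.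
Qed.

(** Truth under an admissible valuation is membership of a substitution instance of [phi], and [L]
    is closed under substitution. *)
Lemma gframe_forces_canonical phi H :
  L phi -> gframe_forces (@canonical_rel L) (range worlds) H phi.
Proof.
move=> Lphi V AV.
have [s Vs] : exists s, forall p, V p = worlds (s p).
  have /choice [s Hs] : forall p, exists a, V p = worlds a.
    by move=> p; have [a _ <-] := AV p; exists a.
  by exists s.
have -> : V = (fun p => worlds (s p)) by apply/funext.
by rewrite truth_worlds; apply: world_L; exact: (nml_subst nL).
Qed.

End Canonical.

Lemma d_persistent_canonical phi : locally_d_persistent phi -> canonical phi.
Proof.
move=> dp L nL Lphi G.
by apply/(dp _ _ _ (canonical_descriptive nL) G); exact: gframe_forces_canonical.
Qed.

Theorem theorem4p15 (phi : ml) (hphi : sqema_succeeds phi) :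
  [/\ locally_d_persistent phi,
      canonical phi
    & forall finals : seq system, successful_execution phi finals ->
        local_fo_equivalent phi (sqema_output finals)].
Proof.
have dp := sqema_locally_d_persistent hphi.
split=> //; first exact: d_persistent_canonical.
exact: sqema_local_fo_equivalent.
Qed.
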